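(* Let $Q_t$ be the number in system at time $t$ of an $M^N/G/\infty$ queue, i.e. an infinite server queue with stationary batch arrival rate $\lambda>0$, random batch sizes given by an i.i.d. sequence of non-negative integer valued random variables $\{N_i\mid i\in\mathbb{Z}^+\}$, and general service distribution $G$. Then the steady-state number in system $Q_\infty$ satisfies $$Q_\infty\stackrel{D}{=}\sum_{n=1}^\infty\sum_{j=1}^n (n-j+1)\,Y_{j,n},$$ where the $Y_{j,n}$ are independent with $Y_{j,n}\sim\mathrm{Pois}\left(\lambda p_n\,\mathbb{E}[S_{(j,n)}-S_{(j-1,n)}]\right)$, $p_n=\mathbb{P}(N_1=n)$, $S_{(1,n)}\le\dots\le S_{(n,n)}$ are the order statistics of an i.i.d. sample of size $n$ from $G$, and $S_{(0,n)}=0$ for all $n$.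
   Context: Model: batches arrive at the epochs of a Poisson process of rate $\lambda$. The $i$-th batch brings $N_i$ customers simultaneously. There are infinitely many servers, so every customer starts service immediately upon arrival and leaves when its service is complete. Service durations of all customers are i.i.d. nonnegative (finite) random variables with distribution $G$; arrival epochs, batch sizes and service durations are mutually independent. $Q_t$ is the number of customers present at time $t$. $Q_\infty$ denotes a random variable with the limiting distribution of $Q_t$ as $t\to\infty$ (starting from an empty system). $\mathrm{Pois}(a)$ is the Poisson distribution with mean $a$, with $\mathrm{Pois}(0)$ the point mass at $0$. In cases where the quantities are not finite, the identity is read in $\{0,1,2,\dots\}\cup\{\infty\}$, with $\mathrm{Pois}(\infty)$ the point mass at $\infty$ and $0\cdot\infty=0$. *)

(* Defs.v *)
From HB Require Import structures.
From mathcomp Require Import all_boot all_order all_algebra finmap.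
From mathcomp Require Import all_classical all_reals all_analysis.
From mathcomp Require Import measurable_realfun.

Set Implicit Arguments.
Unset Strict Implicit.
Unset Printing Implicit Defensive.

Import Order.TTheory GRing.Theory Num.Theory.
Import numFieldNormedType.Exports.

Local Open Scope classical_set_scope.
Local Open Scope ring_scope.

Definition mutually_independent (d : measure_display) (T : measurableType d)
    (R : realType) (P : probability T R) (I : choiceType) (D : set I)
    (F : I -> set (set T)) : Prop :=
  forall (J : {fset I}) (E : I -> set T),
    [set` J] `<=` D -> (forall i, i \in J -> F i (E i)) ->
    P (\big[setI/setT]_(i <- J) E i) = (\prod_(i <- J) P (E i))%E.

Definition sigma_rv (d d' : measure_display) (T : measurableType d)
    (T' : measurableType d') (X : T -> T') : set (set T) :=
  preimage_set_system setT X measurable.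

Definition has_law (d d' : measure_display) (T : measurableType d)
    (T' : measurableType d') (R : realType) (P : probability T R)
    (X : T -> T') (mu : set T' -> \bar R) : Prop :=
  forall A : set T', measurable A -> P (X @^-1` A) = mu A.

Definition iid_sample (d d' : measure_display) (T : measurableType d)
    (T' : measurableType d') (R : realType) (P : probability T R)
    (I : choiceType) (X : I -> {RV P >-> T'}) (mu : set T' -> \bar R) : Prop :=
  mutually_independent P setT (fun i => sigma_rv (X i)) /\
  forall i, has_law P (X i) mu.

(* The value set {0, 1, 2, ...} u {oo}, as a subset of the extended reals. *)
Definition extended_nat (R : realType) : set (\bar R) :=
  range (fun k : nat => k%:R%:E) `|` [set +oo%E].

(* Pois(a), for a in [0, +oo], as a law on the extended reals.  The library's
   poisson_prob is the point mass at 0 when its rate is 0, and it ignores its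
   second argument. *)
Definition poisson_law (R : realType) (a : \bar R) (A : set (\bar R)) : \bar R :=
  if a is r%:E then poisson_prob r 0 [set k : nat | A k%:R%:E]
  else \d_(+oo%E : \bar R) A.

(* The interval that ends at the i-th epoch; the process starts at time 0. *)
Definition gap (T : Type) (R : realType) (tau : nat -> T -> R) (i : nat)
    (w : T) : R :=
  if i is i'.+1 then tau i w - tau i' w else tau 0%N w.

(* The primitive random elements of the queue: gaps, batch sizes, services.
   The gaps generate the same sigma-algebra as the epochs. *)
Definition primitive_sigma (d : measure_display) (T : measurableType d)
    (R : realType) (tau : nat -> T -> R) (N : nat -> T -> nat)
    (serv : nat -> nat -> T -> R) (x : nat + nat + nat * nat) : set (set T) :=
  match x with
  | inl (inl i) => sigma_rv (gap tau i)
  | inl (inr i) => sigma_rv (N i)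
  | inr (i, k) => sigma_rv (serv i k)
  end.

(* Batches and the customers of a batch are numbered from 0: batch i arrives at
   tau i, its customers are k < N i, and customer k has service duration serv i k.
   The Poisson process of rate lambda is given by i.i.d. exponential gaps. *)
Record batch_arrival_queue (d : measure_display) (T : measurableType d)
    (R : realType) (P : probability T R) (lambda : R)
    (G : probability R R)
    (tau : nat -> {RV P >-> R}) (N : nat -> {RV P >-> nat})
    (serv : nat -> nat -> {RV P >-> R}) : Prop := {
  gap_law : forall i,
    has_law P (gap tau i) (exponential_prob lambda) ;
  batch_law : forall i, has_law P (N i) (distribution P (N 0%N)) ;
  service_law : forall i k, has_law P (serv i k) G ;
  primitives_independent :
    mutually_independent P setT (primitive_sigma tau N serv) }.

Definition number_in_system (T : Type) (R : realType) (tau : nat -> T -> R)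
    (N : nat -> T -> nat) (serv : nat -> nat -> T -> R) (t : R) (w : T) : \bar R :=
  (\sum_(0 <= i <oo) \sum_(0 <= k < N i w)
     ((tau i w <= t < tau i w + serv i k w)%R : nat)%:R%:E)%E.

(* Weak convergence of the laws.  A continuous function on the extended reals
   is bounded, since they are compact. *)
Definition limit_in_law (d d' : measure_display) (T : measurableType d)
    (T' : measurableType d') (R : realType) (P : probability T R)
    (X : R -> T -> \bar R) (P' : probability T' R) (Y : T' -> \bar R) : Prop :=
  forall f : \bar R -> R, continuous f ->
    ('E_P[f \o X t] @[t --> +oo%R] --> 'E_P'[f \o Y])%E.

(* The j-th smallest of n values for 1 <= j <= n, and 0 for j = 0. *)
Definition order_stat (T : Type) (R : realType) (n : nat) (X : 'I_n -> T -> R)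
    (j : nat) (w : T) : R :=
  if j is j'.+1 then nth 0 (sort <=%R [seq X k w | k : 'I_n]) j' else 0.

(* Main.v *)
Require Import Defs.
From HB Require Import structures.
From mathcomp Require Import all_boot all_order all_algebra finmap.
From mathcomp Require Import all_classical all_reals all_analysis.
From mathcomp Require Import measurable_realfun.
From mathcomp Require Import ring lra zify.

Set Implicit Arguments.
Unset Strict Implicit.
Unset Printing Implicit Defensive.

Import Order.TTheory GRing.Theory Num.Theory.
Import numFieldNormedType.Exports.

Local Open Scope classical_set_scope.
Local Open Scope ring_scope.

(** The limit law is found through Laplace transforms.  Fix [s > 0] and read
    [e^(-s Q_t)] as a conditional probability: mark every customer independently
    with probability [1 - e^(-s)]; then [E e^(-s Q_t)] is the probability that no
    marked customer is present at time [t].  Let [psi u] be the probability that a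
    batch of age [u] has no marked customer left in service.  The batches that do
    have one form a thinned Poisson process, so
      [E e^(-s Q_t) = exp (- lambda * int_0^t (1 - psi u) du)],
    and this tends to [exp (- lambda M)] with [M = int_0^oo (1 - psi u) du], also
    when [M] is infinite, where both sides vanish ([queue_laplace],
    [marked_mean_limit]).

    The formula for finite [t] is proved by a martingale argument that needs no
    theory of point processes.  Write [H t] for the right-hand side and [a_m] for
    the [m]-th arrival epoch, [a_0 = 0].  The product of the transforms of the
    first [m] batches with [H (t - a_m)] has the same expectation for every [m]:
    integrating out batch [m] and then the gap before it turns the case [m + 1]
    into the case [m], because [H] solves the renewal equation
      [H u = int_0^oo lambda e^(-lambda x) psi (u - x) H (u - x) dx]
    ([renewal_fixed_point], [void_prob_martingale]).  At [m = 0] the expectation is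
    [H t]; as [m] grows it tends to [E e^(-s Q_t)], since [H] is 1 at negative
    arguments and [P (a_m <= t) <= e^t E e^(-a_m)] decays geometrically.

    Put [z = e^(-s)], and let [theta u] be the probability that a customer who
    arrived [u] ago is absent or unmarked.  Then [psi = sum_n p_n theta^n], hence
    [M = sum_n p_n int_0^oo (1 - theta u ^ n) du], and [1 - theta u ^ n] is
    [E (1 - z^c)] for the number [c] of sample points of a sample of size [n] that
    exceed [u].  That number is [n - j + 1] exactly for [u] between the order
    statistics [S_(j-1)] and [S_(j)], so Tonelli's theorem gives
      [int_0^oo (1 - theta u ^ n) du = sum_j (1 - z^(n-j+1)) E (S_(j) - S_(j-1))]
    ([spacing_decomposition]).  Thus [lambda M] is the exponent of the transform of
    the weighted sum of independent Poisson variables ([compound_poisson_laplace],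
    [steady_state_mean]), and the transforms of [Q_t] converge to that of the sum.

    For variables with values in [{0, 1, 2, ...} u {oo}], convergence of the
    transforms forces convergence of each point probability ([laplace_cvg_pmf]).
    A continuous function on the extended reals is nearly constant beyond a finite
    number of integers, so point probabilities control expectations
    ([pmf_cvg_expectation]) and, conversely, are determined by them
    ([expectation_pmf_unique]); this gives the convergence and the uniqueness of
    the limit law. *)

(** * Independence of generated sigma-algebras *)

Section independence_pair.
Context d d1 d2 (T : measurableType d) (T1 : measurableType d1)
  (T2 : measurableType d2) (R : realType) (P : probability T R).

(** Two passes of the uniqueness theorem for finite measures: with one of the
    sets fixed, both sides of the product rule are measures in the other set. *)
Lemma pi_system_independent (G1 G2 : set (set T)) :
  G1 `<=` measurable -> G2 `<=` measurable ->
  setI_closed G1 -> setI_closed G2 -> G1 setT -> G2 setT ->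
  (forall A B, G1 A -> G2 B -> P (A `&` B) = P A * P B)%E ->
  forall A B, <<s G1 >> A -> <<s G2 >> B -> (P (A `&` B) = P A * P B)%E.
Proof.
move=> mG1 mG2 IG1 IG2 TG1 TG2 G12.
have step (G : set (set T)) (B : set T) : G `<=` measurable -> setI_closed G ->
    G setT -> measurable B -> (forall A, G A -> P (A `&` B) = P A * P B)%E ->
    forall A, <<s G >> A -> (P (A `&` B) = P A * P B)%E.
  move=> mG IG TG mB GB A sGA.
  have PB0 : 0 <= fine (P B) by rewrite fine_ge0.
  have -> : (P A * P B)%E = mscale (NngNum PB0) P A.
    by rewrite /mscale/= (fineK (fin_num_measure P _ mB)) muleC.
  rewrite -[P (A `&` B)]/(mrestr P mB A).
  apply: (g_sigma_algebra_measure_unique G mG (fun=> setT)) => //.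
  - by rewrite bigcup_const.
  - move=> C GC.
    transitivity (P (C `&` B)) => //; rewrite GB// muleC.
    change (P B * P C = (fine (P B))%:E * P C)%E.
    by rewrite (fineK (fin_num_measure P _ mB)).
  - move=> _; change (P (setT `&` B) < +oo)%E; rewrite setTI.
    by rewrite ltey_eq (fin_num_measure P _ mB).
have msG (G : set (set T)) : G `<=` measurable -> <<s G >> `<=` measurable.
  by move=> mG; apply: smallest_sub => //; exact: sigma_algebra_measurable.
move=> A B sA sB; apply: (step G1) => //; first exact: msG sB.
move=> C GC; rewrite setIC muleC; apply: (step G2) => //; first exact: mG1.
by move=> D GD; rewrite setIC muleC; exact: G12.
Qed.

(** The product rule says that the joint law of [U] and [V] and the product of
    their laws agree on rectangles, hence everywhere; Tonelli's theorem then
    separates the two variables. *)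
Lemma independent_pair_integral (U : {mfun T >-> T1}) (V : {mfun T >-> T2})
    (f : T1 * T2 -> \bar R) :
  (forall A B, measurable A -> measurable B ->
    P (U @^-1` A `&` V @^-1` B) = P (U @^-1` A) * P (V @^-1` B))%E ->
  measurable_fun setT f -> (forall x, 0 <= f x)%E ->
  (\int[P]_w f (U w, V w) = \int[P]_w \int[P]_w' f (U w, V w'))%E.
Proof.
move=> UV mf f0.
have mUV : measurable_fun setT (fun w => (U w, V w)).
  exact: measurable_fun_pair.
transitivity (\int[distribution P U \x distribution P V]_z f z)%E.
  rewrite [RHS](@eq_measure_integral _ _ _ _ (pushforward P (fun w => (U w, V w)))).
    by rewrite ge0_integral_pushforward.
  move=> A mA _; refine (product_measure_unique _ mA) => B C mB mC; exact: UV.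
rewrite fubini_tonelli1// /fubini_F.
rewrite ge0_integral_distribution//=; last first.
- by move=> x; exact: integral_ge0.
- exact: measurable_fun_fubini_tonelli_F.
apply: eq_integral => w _.
rewrite ge0_integral_distribution//.
exact: measurable_fun_pair2.
Qed.

End independence_pair.

Lemma measurable_fun_big_mule d (T : measurableType d) (R : realType) (I : eqType)
    (s : seq I) (f : I -> T -> \bar R) :
  (forall i, i \in s -> measurable_fun setT (f i)) ->
  measurable_fun setT (fun w => \prod_(i <- s) f i w)%E.
Proof.
elim: s => [_|i s IH mf]; first by (under eq_fun do rewrite big_nil); exact: measurable_cst.
under eq_fun do rewrite big_cons.
apply: emeasurable_funM; first by apply: mf; rewrite inE eqxx.
by apply: IH => j js; apply: mf; rewrite inE js orbT.
Qed.

Section independent_family.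
Context d (T : measurableType d) (R : realType) (P : probability T R)
  (I : choiceType) (D0 : set I) (F : I -> set (set T)).
Hypothesis FI : forall i, setI_closed (F i).
Hypothesis FT : forall i, F i setT.
Hypothesis mF : forall i, F i `<=` measurable.
Hypothesis indF : mutually_independent P D0 F.

(** The finite intersections of events taken from the families in [D].  They
    form a pi-system, which the union of these families does not. *)
Definition cylinders (D : set I) : set (set T) :=
  [set A | exists J : {fset I}, exists E : I -> set T,
     [/\ [set` J] `<=` D, forall i, i \in J -> F i (E i)
       & A = \bigcap_(i in [set` J]) E i]].

Lemma cylindersT D : cylinders D setT.
Proof.
exists fset0, (fun=> setT); split => //.
by apply/seteqP; split.
Qed.

Lemma sub_cylinders i D : D i -> F i `<=` cylinders D.
Proof.
move=> Di A FA; exists [fset i]%fset, (fun=> A); split.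
- by move=> j /=; rewrite inE => /eqP ->.
- by move=> j; rewrite inE => /eqP ->.
- apply/seteqP; split => [w Aw j //|w]; apply => /=.
  by rewrite inE.
Qed.

Lemma measurable_cylinders D : cylinders D `<=` measurable.
Proof.
move=> A [J [E [_ FE ->]]]; rewrite bigcap_fset big_seq.
by apply: bigsetI_measurable => i iJ; exact/mF/FE.
Qed.

Lemma cylinders_setI D : setI_closed (cylinders D).
Proof.
move=> A B [J [E [JD FE ->]]] [J' [E' [JD' FE' ->]]].
exists (J `|` J')%fset, (fun i => (if i \in J then E i else setT) `&`
  (if i \in J' then E' i else setT)); split.
- by move=> i /=; rewrite inE => /orP[/JD|/JD'].
- by move=> i _; apply: FI; case: ifPn => // /[dup]; [move=> _ /FE|move=> _ /FE'].
- apply/seteqP; split => w /=.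
    move=> [EJ EJ'] i /= _; split; case: ifPn => // iJ; [exact: EJ|exact: EJ'].
  move=> EJ; split => i /= iJ.
    have [] := EJ i; first by rewrite /= inE iJ.
    by rewrite iJ.
  have [] := EJ i; first by rewrite /= inE iJ orbT.
  by rewrite iJ.
Qed.

Lemma cylinders_independent D D' : D `<=` D0 -> D' `<=` D0 -> [disjoint D & D'] ->
  forall A B, <<s cylinders D >> A -> <<s cylinders D' >> B ->
  (P (A `&` B) = P A * P B)%E.
Proof.
move=> DD0 D'D0 dis; apply: pi_system_independent => //.
- exact: measurable_cylinders.
- exact: measurable_cylinders.
- exact: cylinders_setI.
- exact: cylinders_setI.
- exact: cylindersT.
- exact: cylindersT.
move=> A B [J [E [JD FE ->]]] [J' [E' [JD' FE' ->]]].
have JJ' i : i \in J' -> i \in J = false.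
  move=> iJ'; apply/negP => iJ; move/disj_setPS : dis => /(_ i); apply.
  by split; [exact: JD|exact: JD'].
pose E2 i := if i \in J then E i else E' i.
have -> : \bigcap_(i in [set` J]) E i `&` \bigcap_(i in [set` J']) E' i =
    \bigcap_(i in [set` (J `|` J')%fset]) E2 i.
  apply/seteqP; split => w /=.
    move=> [EJ EJ'] i /=; rewrite inE /E2; case: ifPn => [iJ _|_ /= iJ'].
      exact: EJ.
    exact: EJ'.
  move=> EJ; split => i /= iJ; have := EJ i; rewrite /E2 /= inE iJ ?orbT.
    by apply.
  by rewrite JJ'//; apply.
rewrite !bigcap_fset (indF (subset_trans JD DD0) FE).
rewrite (indF (subset_trans JD' D'D0) FE') indF; last 2 first.
- by move=> i /=; rewrite inE => /orP[/JD/DD0|/JD'/D'D0].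
- by move=> i; rewrite inE /E2; case: ifPn => [iJ _|_ /= iJ']; [exact: FE|exact: FE'].
rewrite (perm_big (enum_fset J ++ enum_fset J'))/=; last first.
  apply: uniq_perm; rewrite ?fset_uniq// ?cat_uniq ?fset_uniq//=.
    rewrite andbT; apply/hasPn => i iJ'.
    by rewrite JJ'.
  by move=> i; rewrite mem_cat inE.
rewrite big_cat/= !(big_seq _ _ _ (fun i => P _)) /E2; congr (_ * _)%E.
  by apply: eq_bigr => i ->.
by apply: eq_bigr => i iJ'; rewrite JJ'.
Qed.

(** The sample space with the sigma-algebra of the families in [D].  Keeping the
    points and changing only the sigma-algebra lets measurability with respect to
    a group of variables be stated without a tuple-valued variable. *)
Definition subsigma (D : set I) := g_sigma_algebraType (cylinders D).

Definition to_subsigma (D : set I) (w : T) : subsigma D := w.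

Lemma measurable_to_subsigma (D : set I) : measurable_fun setT (@to_subsigma D).
Proof.
move=> _ A mA; rewrite setTI preimage_id.
apply: (smallest_sub _ _ mA); first exact: sigma_algebra_measurable.
exact: measurable_cylinders.
Qed.

Lemma measurable_of_subsigma d' (Y : measurableType d') (D : set I) (f : T -> Y) :
  measurable_fun setT (f : subsigma D -> Y) -> measurable_fun setT f.
Proof.
move=> mf _ A mA; rewrite setTI; rewrite -[f @^-1` A]setTI.
apply: (smallest_sub _ _ (mf measurableT A mA)).
  exact: sigma_algebra_measurable.
exact: measurable_cylinders.
Qed.

Lemma measurable_subsigmaS d' (Y : measurableType d') (D D' : set I) (f : T -> Y) :
  D `<=` D' -> measurable_fun setT (f : subsigma D -> Y) ->
  measurable_fun setT (f : subsigma D' -> Y).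
Proof.
move=> DD' mf _ A mA; have := mf measurableT A mA.
apply: sub_sigma_algebra2 => B [J [E [JD FE ->]]].
by exists J, E; split => //; exact: subset_trans DD'.
Qed.

Lemma measurable_subsigma_rv d' (Y : measurableType d') (D : set I) (i : I)
    (f : T -> Y) : D i -> F i = sigma_rv f ->
  measurable_fun setT (f : subsigma D -> Y).
Proof.
move=> Di Fif _ A mA; apply: sub_sigma_algebra; apply: (sub_cylinders Di).
by rewrite Fif; exists A.
Qed.

(** The tool behind every conditioning step below: variables that belong to
    disjoint groups may be integrated one group at a time. *)
Lemma subsigma_integral (D D' : set I) (f : T * T -> \bar R) :
  D `<=` D0 -> D' `<=` D0 -> [disjoint D & D'] ->
  measurable_fun setT (f : subsigma D * subsigma D' -> \bar R) ->
  (forall x, 0 <= f x)%E ->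
  (\int[P]_w f (w, w) = \int[P]_w \int[P]_w' f (w, w'))%E.
Proof.
move=> DD0 D'D0 dis mf f0.
pose U : {mfun T >-> subsigma D} := HB.pack (@to_subsigma D)
  (isMeasurableFun.Build _ _ _ _ (@to_subsigma D) (@measurable_to_subsigma D)).
pose V : {mfun T >-> subsigma D'} := HB.pack (@to_subsigma D')
  (isMeasurableFun.Build _ _ _ _ (@to_subsigma D') (@measurable_to_subsigma D')).
apply: (@independent_pair_integral _ _ _ _ _ _ _ P U V f) => // A B mA mB.
exact: (cylinders_independent DD0 D'D0 dis).
Qed.

Lemma subsigma_integralM (D D' : set I) (f g : T -> \bar R) :
  D `<=` D0 -> D' `<=` D0 -> [disjoint D & D'] ->
  measurable_fun setT (f : subsigma D -> \bar R) ->
  measurable_fun setT (g : subsigma D' -> \bar R) ->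
  (forall w, 0 <= f w)%E -> (forall w, 0 <= g w)%E ->
  (\int[P]_w (f w * g w) = \int[P]_w f w * \int[P]_w g w)%E.
Proof.
move=> DD0 D'D0 dis mf mg f0 g0.
have mTf := measurable_of_subsigma mf.
have mTg := measurable_of_subsigma mg.
rewrite (@subsigma_integral D D' (fun x => f x.1 * g x.2)%E)//=; last 2 first.
- by apply: emeasurable_funM; [exact: (measurableT_comp mf measurable_fst)
    |exact: (measurableT_comp mg measurable_snd)].
- by move=> x; rewrite mule_ge0.
under eq_integral do rewrite ge0_integralZl//.
by rewrite ge0_integralZr//; exact: integral_ge0.
Qed.

Lemma subsigma_integral_prod (s : seq I) (f : I -> T -> \bar R) :
  uniq s -> [set` s] `<=` D0 ->
  (forall i, i \in s -> measurable_fun setT (f i : subsigma [set i] -> \bar R)) ->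
  (forall i w, 0 <= f i w)%E ->
  (\int[P]_w \prod_(i <- s) f i w = \prod_(i <- s) \int[P]_w f i w)%E.
Proof.
move=> + + + f0; elim: s => [_ _ _|i s IH /= /andP[iNs us] sD0 mf].
  by rewrite big_nil; under eq_integral do rewrite big_nil; rewrite integral_cst//
     mul1e; exact: probability_setT.
have mfs : forall j, j \in s -> measurable_fun setT (f j : subsigma [set j] -> \bar R).
  by move=> j js; apply: mf; rewrite inE js orbT.
have sD0' : [set` s] `<=` D0.
  by move=> j js; apply: sD0 => /=; rewrite inE js orbT.
under eq_integral do rewrite big_cons.
rewrite big_cons -IH// (@subsigma_integralM [set i] [set` s])//.
- by move=> j ->; apply: sD0; rewrite /= inE eqxx.
- by apply/disj_setPS => j [-> /=]; rewrite (negbTE iNs).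
- by apply: mf; rewrite inE eqxx.
- apply: measurable_fun_big_mule => j js.
  by apply: measurable_subsigmaS (mfs _ js) => k ->.
- by move=> w; exact: prode_ge0.
Qed.

End independent_family.

Lemma sigma_rv_setI_closed d d' (T : measurableType d) (T' : measurableType d')
  (f : T -> T') : setI_closed (sigma_rv f).
Proof.
move=> _ _ [A mA <-] [B mB <-]; exists (A `&` B); first exact: measurableI.
by rewrite !setTI.
Qed.

Lemma sigma_rv_setT d d' (T : measurableType d) (T' : measurableType d')
  (f : T -> T') : sigma_rv f setT.
Proof. by exists setT => //; rewrite setTI. Qed.

Lemma sigma_rv_measurable d d' (T : measurableType d) (T' : measurableType d')
  (f : T -> T') : measurable_fun setT f -> sigma_rv f `<=` measurable.
Proof. by move=> mf _ [A mA <-]; exact: mf. Qed.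

(** * Laws on the extended natural numbers *)

Lemma bounded_integrable d (T : measurableType d) (R : realType)
    (P : probability T R) (f : T -> R) (M : R) :
  measurable_fun setT f -> (forall w, `|f w| <= M) ->
  P.-integrable setT (EFin \o f).
Proof.
move=> mf fM; apply: measurable_bounded_integrable => //.
  by rewrite [X in (X < _)%E](probability_setT P) ltry.
by exists M; split; [exact: num_real|move=> x Mx w _; exact: le_trans (fM w) (ltW Mx)].
Qed.

Lemma countable_extended_nat (R : realType) : countable (extended_nat (R := R)).
Proof.
pose f (o : option nat) : \bar R := if o is Some k then k%:R%:E else +oo%E.
have -> : extended_nat (R := R) = range f.
  apply/seteqP; split => [x [[k _ <-]|/= ->]|_ [[k|] _ <-]].
  - by exists (Some k).
  - by exists None.
  - by left; exists k.
  - by right.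
exact: sub_countable (card_image_le f setT) (countableP _).
Qed.

Section extended_nat_law.
Context d (T : measurableType d) (R : realType) (P : probability T R).
Variable X : T -> \bar R.
Hypothesis mX : measurable_fun setT X.
Hypothesis eX : forall w, extended_nat (X w).

(** Because [X] takes countably many values, [g] itself may be arbitrary. *)
Lemma measurable_extended_nat_comp d' (T' : measurableType d')
    (g : \bar R -> T') : measurable_fun setT (g \o X).
Proof.
move=> _ A mA; rewrite setTI.
have -> : (g \o X) @^-1` A = X @^-1` (extended_nat (R := R) `&` g @^-1` A).
  by apply/seteqP; split => [w Aw|w []//]; split => //; exact: eX.
rewrite -[_ @^-1` _]setTI; apply: mX => //.
apply: countable_measurable; first exact: emeasurable_set1.
by apply: sub_countable (countable_extended_nat R); apply: subset_card_le => x [].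
Qed.

Lemma measurable_extended_nat_eq x : measurable (X @^-1` [set x]).
Proof. by rewrite -[_ @^-1` _]setTI; apply: mX => //; exact: emeasurable_set1. Qed.

Definition pmf_nat (k : nat) : R := fine (P (X @^-1` [set k%:R%:E])).

Let approx (g : \bar R -> R) (c : R) (K : nat) (w : T) : R :=
  c + \sum_(j < K) (g j%:R%:E - c) * \1_(X @^-1` [set j%:R%:E]) w.

Let measurable_approx g c K : measurable_fun setT (approx g c K).
Proof.
apply: measurable_funD => //; apply: measurable_sum => j.
apply: measurable_funM => //; apply: measurable_indic.
exact: measurable_extended_nat_eq.
Qed.

Let bounded_approx g c K w :
  `|approx g c K w| <= `|c| + \sum_(j < K) `|g j%:R%:E - c|.
Proof.
apply: (le_trans (ler_normD _ _)); rewrite lerD2l.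
apply: (le_trans (ler_norm_sum _ _ _)); apply: ler_sum => j _.
by rewrite normrM ler_piMr// indicE; case: (_ \in _); rewrite ?normr1 ?normr0.
Qed.

Let integral_approx g c K :
  \int[P]_w approx g c K w = c + \sum_(j < K) (g j%:R%:E - c) * pmf_nat j.
Proof.
elim: K => [|K IH].
  rewrite /approx big_ord0 addr0.
  under eq_Rintegral do rewrite big_ord0 addr0.
  by rewrite Rintegral_cst// [X in fine X](probability_setT P) mulr1.
rewrite big_ord_recr/= addrA -IH.
transitivity (\int[P]_w (approx g c K w +
    (g K%:R%:E - c) * \1_(X @^-1` [set K%:R%:E]) w)).
  by apply: eq_Rintegral => w _; rewrite /approx big_ord_recr/= addrA.
have int1 : P.-integrable setT (EFin \o \1_(X @^-1` [set K%:R%:E])).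
  apply: (@bounded_integrable _ _ _ _ _ 1) => [|w].
    by apply: measurable_indic; exact: measurable_extended_nat_eq.
  by rewrite indicE; case: (_ \in _); rewrite ?normr1 ?normr0.
rewrite RintegralD//.
- rewrite RintegralZl//; congr (_ + _ * _).
  rewrite /Rintegral integral_indic//; first by rewrite setIT.
  exact: measurable_extended_nat_eq.
- by apply: bounded_integrable (bounded_approx g c K); exact: measurable_approx.
- have := integrableZl measurableT (g K%:R%:E - c) int1.
  by apply: eq_integrable.
Qed.

Let approx_nat g c K j : (j < K)%N -> forall w, X w = j%:R%:E ->
  approx g c K w = g j%:R%:E.
Proof.
move=> jK w Xw; rewrite /approx (bigD1 (Ordinal jK))//= big1 => [|i].
  by rewrite addr0 indicE mem_set//= mulr1 addrC subrK.
rewrite -val_eqE/= => ij; rewrite indicE memNset ?mulr0//= Xw => /eqP.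
by rewrite eqe eqr_nat eq_sym (negbTE ij).
Qed.

Let approx_out g c K w : (forall j, (j < K)%N -> X w <> j%:R%:E) ->
  approx g c K w = c.
Proof.
move=> Xw; rewrite /approx big1 ?addr0// => i _.
by rewrite indicE memNset ?mulr0//=; exact: Xw.
Qed.

(** Replacing [g] by the constant [c] from [K] on costs at most [e] at each
    sample point, and what is left takes finitely many values. *)
Lemma extended_nat_expectation_approx (g : \bar R -> R) (c e : R) (K : nat) :
  (forall k, (K <= k)%N -> `|g k%:R%:E - c| <= e) -> `|g +oo%E - c| <= e ->
  P.-integrable setT (EFin \o (g \o X)) /\
  `|\int[P]_w g (X w) - (c + \sum_(j < K) (g j%:R%:E - c) * pmf_nat j)| <= e.
Proof.
move=> gK goo.
have gap w : `|g (X w) - approx g c K w| <= e.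
  case: (eX w) => [[k _ /esym Xk]|/= Xoo].
    have [kK|Kk] := ltnP k K.
      rewrite (approx_nat _ _ kK Xk) Xk subrr normr0.
      by apply: le_trans goo.
    rewrite approx_out => [|j jK]; first by rewrite Xk gK.
    rewrite Xk => /eqP.
    by rewrite eqe eqr_nat => /eqP jk; move: jK; rewrite -jk ltnNge Kk.
  by rewrite approx_out ?Xoo// => j jK; rewrite Xoo.
have intg : P.-integrable setT (EFin \o (g \o X)).
  apply: (@bounded_integrable _ _ _ _ _
    (e + (`|c| + \sum_(j < K) `|g j%:R%:E - c|))) => [|w].
    exact: measurable_extended_nat_comp.
  rewrite -[(g \o X) w](subrK (approx g c K w)).
  apply: (le_trans (ler_normD _ _)); apply: lerD; last exact: bounded_approx.
  exact: gap.
split => //.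
have inta : P.-integrable setT (EFin \o approx g c K).
  by apply: bounded_integrable (bounded_approx g c K); exact: measurable_approx.
rewrite -integral_approx -RintegralB//.
have mD : measurable_fun setT (fun w => g (X w) - approx g c K w).
  by apply: measurable_funB => //; exact: measurable_extended_nat_comp.
apply: (le_trans (le_normr_Rintegral _ _)) => //.
  exact: bounded_integrable gap.
have -> : e = \int[P]_w e.
  by rewrite Rintegral_cst// [X in fine X](probability_setT P) mulr1.
apply: le_Rintegral => //.
  apply: (@bounded_integrable _ _ _ _ _ e) => [|w]; last by rewrite normr_id.
  exact: measurableT_comp.
by apply: (@bounded_integrable _ _ _ _ _ `|e|) => // w; rewrite /cst.
Qed.

End extended_nat_law.

(** * Laplace transforms and convergence in law *)

(** For [s > 0] the value at [+oo] is 0, in accordance with [e^(-oo) = 0]. *)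
Definition laplace (R : realType) (s : R) (x : \bar R) : R :=
  fine (expeR (- (s%:E * x))).

Lemma laplace_fin (R : realType) (s r : R) : laplace s r%:E = expR (- (s * r)).
Proof. by []. Qed.

Lemma laplace_pinfty (R : realType) (s : R) : 0 < s -> laplace s +oo%E = 0.
Proof. by move=> s0; rewrite /laplace gt0_muley ?lte_fin. Qed.

(** From [e^x >= 1 + x >= x] at [x = e^-1]; it shows how large an exponent is
    needed to get below [e]. *)
Lemma expRN_div_le (R : realType) (e : R) : 0 < e -> expR (- e^-1) <= e.
Proof.
move=> e0; rewrite expRN -[leRHS]invrK lef_pV2 ?posrE ?expR_gt0 ?invr_gt0//.
by apply: le_trans (expR_ge1Dx _); rewrite lerDr.
Qed.

Section laplace_pmf.
Context d (T : measurableType d) (R : realType) (P : probability T R).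
Variable X : T -> \bar R.
Hypothesis mX : measurable_fun setT X.
Hypothesis eX : forall w, extended_nat (X w).

Lemma laplace_pmf_approx (s : R) (K : nat) : 0 < s ->
  `|\int[P]_w laplace s (X w) -
    \sum_(j < K) expR (- (s * j%:R)) * pmf_nat P X j| <= expR (- (s * K%:R)).
Proof.
move=> s0.
have tail k : (K <= k)%N -> `|laplace s k%:R%:E - 0| <= expR (- (s * K%:R)).
  move=> Kk; rewrite laplace_fin subr0 ger0_norm ?expR_ge0//.
  by rewrite ler_expR lerN2 ler_wpM2l ?ler_nat// ltW.
have tailoo : `|laplace s +oo%E - 0| <= expR (- (s * K%:R)).
  by rewrite laplace_pinfty// subrr normr0 expR_ge0.
have [_] := extended_nat_expectation_approx P mX eX tail tailoo.
by rewrite add0r; under eq_bigr do rewrite laplace_fin subr0.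
Qed.

End laplace_pmf.

Section continuous_functional.
Context d (T : measurableType d) (R : realType) (P : probability T R).

(** Continuity at [+oo], read along the integers. *)
Lemma continuous_tail_nat (f : \bar R -> R) (e : R) : continuous f -> 0 < e ->
  exists K, forall k, (K <= k)%N -> `|f k%:R%:E - f +oo%E| <= e.
Proof.
move=> cf e0; have /cvgrPdist_le/(_ _ e0)[M [_ fM]] := cf +oo%E.
exists (Num.bound `|M|) => k Kk; rewrite distrC; apply: fM.
rewrite lte_fin (le_lt_trans (ler_norm M))//.
by rewrite (lt_le_trans (archi_boundP (normr_ge0 M)))// ler_nat.
Qed.

Lemma continuous_extended_nat_expectation (f : \bar R -> R) (X : T -> \bar R) :
  continuous f -> measurable_fun setT X -> (forall w, extended_nat (X w)) ->
  ('E_P[f \o X] = (\int[P]_w f (X w))%:E)%E.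
Proof.
move=> cf mX eX; have [K fK] := continuous_tail_nat cf ltr01.
have foo : `|f +oo%E - f +oo%E| <= 1 by rewrite subrr normr0.
have [intf _] := extended_nat_expectation_approx P mX eX fK foo.
by rewrite unlock /Rintegral fineK//; exact: integrable_fin_num.
Qed.

End continuous_functional.

Section continuity_theorem.
Context d2 (T2 : measurableType d2) (R : realType) (P2 : probability T2 R).
Context d (T : measurableType d) (P : probability T R).
Context (I : Type) (F : set_system I) {FF : ProperFilter F}.
Variables (X : I -> T -> \bar R) (Z : T2 -> \bar R).
Hypothesis mX : forall i, measurable_fun setT (X i).
Hypothesis eX : forall i w, extended_nat (X i w).
Hypothesis mZ : measurable_fun setT Z.
Hypothesis eZ : forall w, extended_nat (Z w).

(** Induction on [k].  With [z = e^(-s)], subtract from the transform the terms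
    below [k] and divide by [z^k]: the outcome differs from the [k]-th point
    probability by at most [z], which is as small as desired, while for fixed [s]
    it converges by hypothesis. *)
Lemma laplace_cvg_pmf :
  (forall s, 0 < s ->
    \int[P]_w laplace s (X i w) @[i --> F] --> \int[P2]_w laplace s (Z w)) ->
  forall k, pmf_nat P (X i) k @[i --> F] --> pmf_nat P2 Z k.
Proof.
move=> cvgL; elim/ltn_ind => k IH; apply/cvgrPdist_le => e e0.
(* With this exponent [e^(-s) <= e / 4], so the two tails and the convergent part
   contribute at most [e / 4] each after division by [z k]. *)
pose s := (e / 4)^-1; have s0 : 0 < s by rewrite invr_gt0 divr_gt0.
pose z j := expR (- (s * j%:R)).
have z0 j : 0 < z j by exact: expR_gt0.
have zS : z k.+1 <= z k * (e / 4).
  rewrite /z -natr1 mulrDr mulr1 opprD expRD ler_pM2l ?expR_gt0//.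
  by rewrite expRN_div_le// divr_gt0.
pose G i := \int[P]_w laplace s (X i w) - \sum_(j < k) z j * pmf_nat P (X i) j.
pose G2 := \int[P2]_w laplace s (Z w) - \sum_(j < k) z j * pmf_nat P2 Z j.
have GG2 : G i @[i --> F] --> G2.
  apply: cvgB; first exact: cvgL.
  apply: cvg_big; first by move=> x; exact: add_continuous.
  by move=> j _; apply: cvgMr; exact: IH.
move/cvgrPdist_le : GG2 => /(_ (z k * (e / 4))) => /(_ (mulr_gt0 (z0 _) _)).
move=> /(_ (divr_gt0 e0 _)) => /(_ (ltr0n _ _)) GG2.
near=> i.
have GGi : `|G2 - G i| <= z k * (e / 4) by near: i.
have := laplace_pmf_approx P (mX i) (eX i) k.+1 s0.
have := laplace_pmf_approx P2 mZ eZ k.+1 s0.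
rewrite !big_ord_recr/= !opprD !addrA -/(G i) -/G2 -!/(z _) => H2 H1.
rewrite -(ler_pM2l (z0 k)) -[X in X * `|_|]gtr0_norm// -normrM.
have -> : z k * (pmf_nat P2 Z k - pmf_nat P (X i) k) =
  (G2 - G i) - (G2 - z k * pmf_nat P2 Z k) + (G i - z k * pmf_nat P (X i) k).
  by ring.
apply: (le_trans (ler_normD _ _)).
apply: (@le_trans _ _ ((z k * (e / 4) + z k * (e / 4)) + z k * (e / 4))).
  apply: lerD; last exact: le_trans zS.
  by apply: (le_trans (ler_normB _ _)); apply: lerD => //; exact: le_trans zS.
by rewrite -!mulrDr ler_pM2l//; lra.
Unshelve. all: by end_near.
Qed.

Lemma pmf_cvg_expectation (f : \bar R -> R) : continuous f ->
  (forall k, pmf_nat P (X i) k @[i --> F] --> pmf_nat P2 Z k) ->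
  ('E_P[f \o X i] @[i --> F] --> 'E_P2[f \o Z])%E.
Proof.
move=> cf cvgp.
rewrite (_ : (fun i => 'E_P[f \o X i])%E =
    EFin \o (fun i => \int[P]_w f (X i w))); last first.
  by apply/funext => i; rewrite /= continuous_extended_nat_expectation.
rewrite continuous_extended_nat_expectation//.
apply: cvg_EFin; first by near=> i.
apply/cvgrPdist_le => e e0.
have e30 : 0 < e / 3 by rewrite divr_gt0.
have [K fK] := continuous_tail_nat cf e30.
have foo : `|f +oo%E - f +oo%E| <= e / 3 by rewrite subrr normr0 ltW.
pose A i := f +oo%E + \sum_(j < K) (f j%:R%:E - f +oo%E) * pmf_nat P (X i) j.
pose A2 := f +oo%E + \sum_(j < K) (f j%:R%:E - f +oo%E) * pmf_nat P2 Z j.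
have AA2 : A i @[i --> F] --> A2.
  apply: cvgD; first exact: cvg_cst.
  apply: cvg_big; first by move=> x; exact: add_continuous.
  by move=> j _; apply: cvgMr; exact: cvgp.
move/cvgrPdist_le : AA2 => /(_ _ e30) AA2.
near=> i.
have Ai : `|A2 - A i| <= e / 3 by near: i.
have [_] := extended_nat_expectation_approx P (mX i) (eX i) fK foo.
have [_] := extended_nat_expectation_approx P2 mZ eZ fK foo.
rewrite -/(A i) -/A2 => H2 H1 /=.
have -> : \int[P2]_w f (Z w) - \int[P]_w f (X i w) =
  (\int[P2]_w f (Z w) - A2) + (A2 - A i) - (\int[P]_w f (X i w) - A i) by ring.
apply: (le_trans (ler_normB _ _)).
apply: (@le_trans _ _ (e / 3 + e / 3 + e / 3)); last by lra.
apply: lerD => //; apply: (le_trans (ler_normD _ _)); exact: lerD.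
Unshelve. all: by end_near.
Qed.

End continuity_theorem.

(** It is 1 at [a] and vanishes at distance at least 1 from [a] and at the infinite
    points, so it isolates one integer. *)
Definition tent (R : realType) (a : R) (x : \bar R) : R :=
  if x is r%:E then Num.max 0 (1 - `|r - a|) else 0.

Lemma continuous_tent (R : realType) (a : R) : continuous (tent a).
Proof.
move=> [r||].
- have cr : {for r, continuous ((cst 0 : R -> R^o) \max (fun y => 1 - `|y - a|))}.
    apply: continuous_max; first exact: cst_continuous.
    apply: cvgB; first exact: cvg_cst.
    by apply: cvg_norm; apply: cvgB; [exact: cvg_id|exact: cvg_cst].
  by move=> A nA; exact: cr nA.
- move=> A /nbhs_singleton/= A0; exists (a + 1); split; first exact: num_real.
  move=> [y||] //=; rewrite lte_fin => ay.
  suff -> : Num.max 0 (1 - `|y - a|) = 0 by [].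
  by apply/max_idPl; rewrite subr_le0 ger0_norm; lra.
- move=> A /nbhs_singleton/= A0; exists (a - 1); split; first exact: num_real.
  move=> [y||] //=; rewrite lte_fin => ay.
  suff -> : Num.max 0 (1 - `|y - a|) = 0 by [].
  by apply/max_idPl; rewrite subr_le0 ler0_norm; lra.
Qed.

Section uniqueness.
Context d2 (T2 : measurableType d2) (R : realType) (P2 : probability T2 R).
Context d (T : measurableType d) (P : probability T R).
Variables (X : T -> \bar R) (Z : T2 -> \bar R).
Hypothesis mX : measurable_fun setT X.
Hypothesis eX : forall w, extended_nat (X w).
Hypothesis mZ : measurable_fun setT Z.
Hypothesis eZ : forall w, extended_nat (Z w).

Lemma expectation_pmf_unique :
  (forall f : \bar R -> R, continuous f -> 'E_P[f \o X] = 'E_P2[f \o Z])%E ->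
  forall k, pmf_nat P X k = pmf_nat P2 Z k.
Proof.
move=> XZ k; pose f := tent (k%:R : R).
have fk : f k%:R%:E = 1 by rewrite /f/= subrr normr0 subr0 (max_idPr _).
have fj j : (j != k)%N -> f j%:R%:E = 0.
  move=> jk; rewrite /f/=; apply/max_idPl; rewrite subr_le0.
  have : (1 <= `|j%:Z - k%:Z|)%R by rewrite -gtz0_ge1 normr_gt0 subr_eq0.
  by rewrite -(ler_int R) intr_norm rmorphB.
have ftail j : (k.+1 <= j)%N -> `|f j%:R%:E - 0| <= 0.
  by move=> kj; rewrite fj ?subrr ?normr0// gtn_eqF.
have foo : `|f +oo%E - 0| <= 0 by rewrite subrr normr0.
have cf : continuous f by exact: continuous_tent.
clearbody f.
have pmfE d' (T' : measurableType d') (P' : probability T' R) (W : T' -> \bar R) :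
    measurable_fun setT W -> (forall w, extended_nat (W w)) ->
    pmf_nat P' W k = \int[P']_w f (W w).
  move=> mW eW; have [_] := extended_nat_expectation_approx P' mW eW ftail foo.
  rewrite normr_le0 subr_eq0 => /eqP ->.
  rewrite add0r big_ord_recr/= fk subr0 mul1r big1 ?add0r// => j _.
  by rewrite fj ?ltn_eqF// subrr mul0r.
rewrite !pmfE//; have := XZ f cf.
by rewrite !continuous_extended_nat_expectation// => -[].
Qed.

(** The mass at [+oo] is what the integers leave over. *)
Lemma pmf_law_unique : (forall k, pmf_nat P X k = pmf_nat P2 Z k) ->
  forall A, measurable A -> P (X @^-1` A) = P2 (Z @^-1` A).
Proof.
move=> XZ.
pose atom (B : set (\bar R)) k := B `&` [set k%:R%:E].
pose fin_part (B : set (\bar R)) := \bigcup_k atom B k.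
have finE d' (T' : measurableType d') (P' : probability T' R) (W : T' -> \bar R) B :
    measurable_fun setT W -> P' (W @^-1` fin_part B) =
    (\sum_(0 <= k <oo) if k%:R%:E \in B then (pmf_nat P' W k)%:E else 0)%E.
  move=> mW; rewrite preimage_bigcup.
  have atomE k : W @^-1` (atom B k) =
      if k%:R%:E \in B then W @^-1` [set k%:R%:E] else set0.
    apply/seteqP; split => w; case: ifPn; rewrite ?inE ?notin_setE /atom/=.
    - by move=> _ [].
    - by move=> nB [+ Wk]; rewrite Wk.
    - by move=> Bk Wk; split => //; rewrite Wk.
    - by [].
  rewrite measure_bigcup//=; last 2 first.
  - by move=> k _; rewrite atomE; case: ifPn => // _; exact: measurable_extended_nat_eq.
  - move=> i j _ _ [w [[_ /= ->]]] [_ /= /eqP].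
    by rewrite eqe eqr_nat => /eqP.
  rewrite (eq_eseriesl (Q := xpredT)); last by move=> k; rewrite in_setT.
  apply: eq_eseriesr => k _; rewrite atomE; case: ifPn => // _.
  by rewrite /pmf_nat fineK// fin_num_measure//; exact: measurable_extended_nat_eq.
have mfin d' (T' : measurableType d') (W : T' -> \bar R) B :
    measurable_fun setT W -> measurable (W @^-1` fin_part B).
  move=> mW; rewrite -[_ @^-1` _]setTI; apply: mW => //.
  apply: bigcup_measurable => k _.
  apply: countable_measurable; first exact: emeasurable_set1.
  exact: sub_countable (subset_card_le (@subIsetr _ _ _)) (countable1 _).
have finXZ B : P (X @^-1` fin_part B) = P2 (Z @^-1` fin_part B).
  by rewrite !finE//; apply: eq_eseriesr => k _; rewrite XZ.
have oo d' (T' : measurableType d') (P' : probability T' R) (W : T' -> \bar R) :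
    measurable_fun setT W -> (forall w, extended_nat (W w)) ->
    P' (W @^-1` [set +oo%E]) = (1 - P' (W @^-1` fin_part setT))%E.
  move=> mW eW; rewrite -probability_setC; last exact: mfin.
  congr (P' _); apply/seteqP; split => w /=.
    by move=> Wo [k _ [_ /=]]; rewrite Wo.
  by case: (eW w) => // -[k _ Wk] []; exists k.
have splitA d' (T' : measurableType d') (P' : probability T' R) (W : T' -> \bar R) A :
    measurable_fun setT W -> (forall w, extended_nat (W w)) ->
    P' (W @^-1` A) = (P' (W @^-1` fin_part A) +
      if +oo%E \in A then P' (W @^-1` [set +oo%E]) else 0)%E.
  move=> mW eW.
  rewrite (_ : W @^-1` A = W @^-1` fin_part A `|`
      (if +oo%E \in A then W @^-1` [set +oo%E] else set0)); last first.
    apply/seteqP; split => w /=.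
      case: (eW w) => [[k _ Wk] Aw|/= Wo Aw]; first by left; exists k.
      by right; rewrite mem_set//= -Wo.
    by move=> [[k _ []]//|]; case: ifPn => // /[!inE] Aoo /= ->.
  rewrite measureU//; first by congr (_ + _)%E; case: ifPn; rewrite ?measure0.
  - exact: mfin.
  - by case: ifPn => // _; exact: measurable_extended_nat_eq.
  - apply/seteqP; split => // w [[k _ [_ /= Wk]]]; case: ifPn => //= _.
    by rewrite Wk.
by move=> A _; rewrite (splitA _ _ P)// (splitA _ _ P2)// finXZ !oo// finXZ.
Qed.

End uniqueness.

(** * Exponentials of indefinite integrals *)

Section exponential_antiderivative.
Context (R : realType) (psi J : R -> R) (lambda : R).
Local Notation mu := (@lebesgue_measure R).
Hypothesis lambda_gt0 : 0 < lambda.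
Hypothesis mpsi : measurable_fun setT psi.
Hypothesis psi01 : forall x, 0 <= psi x <= 1.
Hypothesis JE : forall v w, v <= w -> J w - J v = \int[mu]_(y in `]v, w]) psi y.

Let K u := expR (lambda * J u).

Lemma itv_oc_measure (v w : R) : v <= w -> mu `]v, w] = (w - v)%:E.
Proof.
by rewrite lebesgue_measure_itv/= lte_fin le_eqVlt => /predU1P[->|->];
  rewrite ?ltxx ?subrr.
Qed.

Lemma bounded_integrable_oc (f : R -> R) (M v w : R) :
  measurable_fun setT f -> (forall x, v < x <= w -> `|f x| <= M) -> v <= w ->
  mu.-integrable `]v, w] (EFin \o f).
Proof.
move=> mf fM vw; apply: measurable_bounded_integrable => //.
- by rewrite [X in (X < _)%E](itv_oc_measure vw) ltry.
- exact: measurable_funTS.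
- exists M; split; [exact: num_real|move=> x Mx y].
  rewrite /= in_itv/= => yvw; exact: le_trans (fM _ yvw) (ltW Mx).
Qed.

Lemma antiderivative_increment v w : v <= w -> 0 <= J w - J v <= w - v.
Proof.
move=> vw; rewrite JE//; apply/andP; split.
  by apply: Rintegral_ge0 => x _; case/andP: (psi01 x).
rewrite [leRHS](_ : _ = \int[mu]_(y in `]v, w]) (cst 1) y); last first.
  by rewrite Rintegral_cst// mul1r [X in fine X](itv_oc_measure vw).
apply: le_Rintegral => //.
- apply: (@bounded_integrable_oc _ 1) => // x _.
  by case/andP: (psi01 x) => p0 p1; rewrite ger0_norm.
- by apply: (@bounded_integrable_oc _ 1) => // x _; rewrite normr1.
- by move=> x _; case/andP: (psi01 x).
Qed.

Lemma antiderivative_homo : {homo J : v w / v <= w}.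
Proof. by move=> v w /antiderivative_increment /andP[+ _]; rewrite subr_ge0. Qed.

Let K_homo : {homo K : v w / v <= w}.
Proof. by move=> v w vw; rewrite ler_expR ler_wpM2l ?(ltW lambda_gt0)// antiderivative_homo. Qed.

Let mK : measurable_fun setT K.
Proof. exact: nondecreasing_measurable. Qed.

Let K_gt0 u : 0 < K u. Proof. exact: expR_gt0. Qed.

Let mintegrand : measurable_fun setT (fun y => lambda * psi y * K y).
Proof. by apply: measurable_funM => //; exact: measurable_funM. Qed.

Let integrable_integrand v w : v <= w ->
  mu.-integrable `]v, w] (EFin \o (fun y => lambda * psi y * K y)).
Proof.
apply: (@bounded_integrable_oc _ (lambda * K w)) => // x /andP[_ xw].
have /andP[p0 p1] := psi01 x.
rewrite !normrM !(ger0_norm p0) (gtr0_norm lambda_gt0) (gtr0_norm (K_gt0 x)).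
apply: ler_pM; [by rewrite mulr_ge0// ltW|exact: ltW| |exact: K_homo].
by rewrite ler_piMr// ltW.
Qed.

Let step v w : v <= w ->
  `|K w - K v - \int[mu]_(y in `]v, w]) (lambda * psi y * K y)| <=
  (lambda * (w - v)) ^+ 2 * K w.
Proof.
move=> vw.
set a := lambda * (J w - J v).
have /andP[J0 J1] := antiderivative_increment vw.
have a0 : 0 <= a by rewrite mulr_ge0// ltW.
have a1 : a <= lambda * (w - v) by rewrite ler_pM2l.
have KwE : K w = K v * expR a.
  by rewrite /K /a -expRD; congr expR; ring.
have KvE : K v = K w * expR (- a).
  by rewrite KwE -mulrA -expRD subrr expR0 mulr1.
have intc c : \int[mu]_(y in `]v, w]) (lambda * psi y * c) = a * c.
  rewrite /a JE//.
  have ipsi : mu.-integrable `]v, w] (EFin \o psi).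
    apply: (@bounded_integrable_oc _ 1) => // x _.
    by case/andP: (psi01 x) => p0 p1; rewrite ger0_norm.
  transitivity (\int[mu]_(y in `]v, w]) ((lambda * c) * psi y)).
    by apply: eq_Rintegral => y _; ring.
  by rewrite RintegralZl//; ring.
have intci c : mu.-integrable `]v, w] (EFin \o (fun y => lambda * psi y * c)).
  apply: (@bounded_integrable_oc _ (lambda * `|c|)) => //.
    by apply: measurable_funM => //; exact: measurable_funM.
  move=> x _; have /andP[p0 p1] := psi01 x.
  by rewrite !normrM (ger0_norm p0) (gtr0_norm lambda_gt0) ler_wpM2r// ler_piMr// ltW.
(* Both the integral and the increment of [K] lie in [[a K v, a K w]]. *)
have lo : a * K v <= \int[mu]_(y in `]v, w]) (lambda * psi y * K y).
  rewrite -intc; apply: le_Rintegral => //; first exact: integrable_integrand.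
  move=> x; rewrite /= in_itv/= => /andP[vx _]; have /andP[p0 _] := psi01 x.
  by rewrite ler_wpM2l ?mulr_ge0 ?(ltW lambda_gt0)//; apply: K_homo; exact: ltW.
have hi : \int[mu]_(y in `]v, w]) (lambda * psi y * K y) <= a * K w.
  rewrite -intc; apply: le_Rintegral => //; first exact: integrable_integrand.
  move=> x; rewrite /= in_itv/= => /andP[_ xw]; have /andP[p0 _] := psi01 x.
  by rewrite ler_wpM2l ?mulr_ge0 ?(ltW lambda_gt0)//; apply: K_homo.
have lo2 : a * K v <= K w - K v.
  rewrite KwE -[X in _ - X]mulr1 -mulrBr mulrC ler_pM2l// lerBrDl.
  exact: expR_ge1Dx.
have hi2 : K w - K v <= a * K w.
  rewrite KvE -[X in X - _]mulr1 -mulrBr mulrC ler_pM2r// lerBlDl -lerBlDr.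
  exact: expR_ge1Dx.
apply: (@le_trans _ _ (a * (K w - K v))).
  by rewrite ler_norml; apply/andP; split; lra.
apply: (@le_trans _ _ (a * (a * K w))); first by rewrite ler_wpM2l.
rewrite mulrA -expr2 ler_wpM2r ?(ltW (K_gt0 _))//.
by rewrite lerXn2r ?nnegrE// mulr_ge0 ?subr_ge0// ltW.
Qed.

(** This is the fundamental theorem of calculus for [exp (lambda J)], where [J]
    need not be differentiable everywhere because [psi] is only measurable.  On a
    short interval both sides lie between the values that monotonicity of [J]
    gives, so they differ by a multiple of the squared length; cutting [v, w] into
    [n] equal pieces leaves a discrepancy of order [1 / n]. *)
Lemma expR_antiderivative_integral v w : v <= w ->
  \int[mu]_(y in `]v, w]) (lambda * psi y * expR (lambda * J y)) =
  expR (lambda * J w) - expR (lambda * J v).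
Proof.
move=> vw; rewrite -!/(K _).
under eq_Rintegral do rewrite -/(K _).
pose D x := K x - K v - \int[mu]_(y in `]v, x]) (lambda * psi y * K y).
pose C := lambda ^+ 2 * K w.
have C0 : 0 <= C by rewrite mulr_ge0 ?sqr_ge0// ltW.
have Dstep x y : v <= x -> x <= y -> y <= w -> `|D y - D x| <= C * (y - x) ^+ 2.
  move=> vx xy yw.
  have -> : D y - D x = K y - K x - \int[mu]_(z in `]x, y]) (lambda * psi z * K z).
    rewrite -(@Rintegral_itvB _ _ (BRight v) (BRight y) x)//.
      by rewrite /D; ring.
    by apply: integrable_integrand; exact: le_trans xy.
  apply: (le_trans (step xy)).
  rewrite exprMn /C [leRHS]mulrAC.
  by apply: ler_wpM2l; [rewrite mulr_ge0// sqr_ge0|exact: K_homo].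
have DN n : `|D w| <= C * (w - v) ^+ 2 / n.+1%:R.
  pose h := (w - v) / n.+1%:R.
  have h0 : 0 <= h by rewrite divr_ge0// subr_ge0.
  have hk k : (k <= n.+1)%N -> v + h * k%:R <= w.
    move=> kn; rewrite -lerBrDl /h mulrAC ler_pdivrMr// ler_wpM2l ?subr_ge0//.
    by rewrite ler_nat.
  have Dk k : (k <= n.+1)%N -> `|D (v + h * k%:R)| <= k%:R * (C * h ^+ 2).
    elim: k => [_|k IH kn].
      rewrite mulr0 addr0 mul0r /D set_itvoc0 ?lexx// Rintegral_set0.
      by rewrite subrr subr0 normr0.
    have := Dstep (v + h * k%:R) (v + h * k.+1%:R) _ _ (hk _ kn).
    rewrite lerDl mulr_ge0// lerD2l ler_wpM2l ?ler_nat// => /(_ isT isT).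
    have -> : v + h * k.+1%:R - (v + h * k%:R) = h by rewrite -natr1; ring.
    move=> H; rewrite [leRHS](_ : _ = C * h ^+ 2 + k%:R * (C * h ^+ 2)); last first.
      by rewrite -natr1; ring.
    rewrite -[D _](subrK (D (v + h * k%:R))).
    apply: (le_trans (ler_normD _ _)); apply: lerD => //; apply: IH; exact: ltnW.
  have := Dk n.+1 (leqnn _).
  have -> : v + h * n.+1%:R = w by rewrite /h divfK// addrC subrK.
  by move=> /le_trans; apply; rewrite /h le_eqVlt; apply/orP; left; apply/eqP; field.
suff /eqP : D w = 0 by rewrite /D subr_eq0 => /eqP <-.
apply/eqP; rewrite -normr_le0; apply/ler_addgt0Pl => e e0; rewrite addr0.
pose n := Num.bound (C * (w - v) ^+ 2 / e).
apply: (le_trans (DN n)); rewrite ler_pdivrMr// -ler_pdivrMl// mulrC.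
apply: ltW; apply: (lt_trans (archi_boundP _)); last by rewrite ltr_nat.
by rewrite divr_ge0 ?(mulr_ge0 C0 (sqr_ge0 _))// ltW.
Qed.

End exponential_antiderivative.

(** * The renewal equation of the void probability *)

Section density.
Context d (T : measurableType d) (R : realType).
Import HBNNSimple.

(** True for indicators by hypothesis, for simple functions by linearity, and in
    general by monotone convergence. *)
Lemma ge0_integral_density (m nu : {measure set T -> \bar R}) (g : T -> R)
    (f : T -> \bar R) :
  measurable_fun setT g -> (forall x, 0 <= g x) ->
  (forall A, measurable A -> nu A = \int[m]_(x in A) (g x)%:E)%E ->
  measurable_fun setT f -> (forall x, 0 <= f x)%E ->
  (\int[nu]_x f x = \int[m]_x (f x * (g x)%:E))%E.
Proof.
move=> mg g0 nug mf f0.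
have mEg : measurable_fun setT (EFin \o g) by exact/measurable_EFinP.
pose h := nnsfun_approx measurableT mf.
have hf x : ((h n x)%:E @[n --> \oo] --> f x)%E by exact: cvg_nnsfun_approx.
have mh n : measurable_fun setT (EFin \o h n) by exact/measurable_EFinP.
have hnd x : {homo (fun n => (h n x)%:E) : a b / (a <= b)%N >-> (a <= b)%E}.
  by move=> a b ab; rewrite lee_fin; exact/lefP/nd_nnsfun_approx.
have hgnd x : {homo (fun n => (h n x)%:E * (g x)%:E)%E :
    a b / (a <= b)%N >-> (a <= b)%E}.
  by move=> a b ab; rewrite lee_wpmul2r ?lee_fin//; exact: hnd.
have hgf x : ((h n x)%:E * (g x)%:E @[n --> \oo] --> f x * (g x)%:E)%E.
  exact: cvgeZr.
transitivity (limn (fun n => \int[nu]_x (h n x)%:E)%E).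
  rewrite -monotone_convergence//; last by move=> n x _; rewrite lee_fin.
  by apply: eq_integral => x _; apply/esym/cvg_lim => //; exact: hf.
transitivity (limn (fun n => \int[m]_x ((h n x)%:E * (g x)%:E))%E); last first.
  rewrite -monotone_convergence//.
  - by apply: eq_integral => x _; apply/cvg_lim => //; exact: hgf.
  - by move=> n; exact: (emeasurable_funM (mh n) mEg).
  - by move=> n x _; rewrite mule_ge0// lee_fin.
congr (limn _); apply/funext => n.
have mlev r : measurable (h n @^-1` [set r]) by exact: measurable_sfunP.
transitivity (\int[nu]_x \sum_(y \in range (h n)) (y * \1_(h n @^-1` [set y]) x)%:E)%E.
  by apply: eq_integral => x _; rewrite fimfunE -fsumEFin.
rewrite ge0_integral_fsum//; last 2 first.
- by move=> r; apply/measurable_EFinP; exact: measurable_funM.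
- by move=> r x _; exact: nnfun_muleindic_ge0.
transitivity (\int[m]_x \sum_(y \in range (h n))
    ((y * \1_(h n @^-1` [set y]) x)%:E * (g x)%:E))%E; last first.
  apply: eq_integral => x _.
  rewrite -ge0_mule_fsuml; first by rewrite fsumEFin// -fimfunE.
  by move=> r; exact: nnfun_muleindic_ge0.
rewrite ge0_integral_fsum//; last 2 first.
- move=> r; apply: (emeasurable_funM _ mEg).
  by apply/measurable_EFinP; exact: measurable_funM.
- by move=> r x _; rewrite mule_ge0 ?lee_fin// -lee_fin; exact: nnfun_muleindic_ge0.
apply: eq_fsbigr => r; rewrite inE => -[w _ <-].
have r0 : 0 <= h n w by [].
rewrite integralZl_indic_nnsfun// integral_indic// setIT nug//.
transitivity (\int[m]_x ((h n w)%:E * (\1_(h n @^-1` [set h n w]) x * g x)%:E))%E; last first.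
  by apply: eq_integral => x _; rewrite -!EFinM mulrA.
rewrite ge0_integralZl//; last 2 first.
- by apply/measurable_EFinP; apply: measurable_funM.
- by move=> x _; rewrite lee_fin mulr_ge0.
congr (_ * _)%E; rewrite [LHS]integral_mkcond/=; apply: eq_integral => x _.
by rewrite /patch indicE; case: ifPn => /= _; rewrite ?mul1r ?mul0r.
Qed.

End density.

Lemma lebesgue_measure_reflect (R : realType) (u : R) (A : set R) :
  measurable A ->
  pushforward lebesgue_measure (fun x : measurableTypeR R => u - x : measurableTypeR R) A =
  lebesgue_measure A.
Proof.
move=> mA.
have mphi : measurable_fun setT (fun x : measurableTypeR R => u - x : measurableTypeR R).
  exact: measurable_funB.
pose phi : {mfun measurableTypeR R >-> measurableTypeR R} := HB.pack
  (fun x : measurableTypeR R => u - x : measurableTypeR R)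
  (isMeasurableFun.Build _ _ _ _ _ mphi).
rewrite (lebesgue_measure_unique (mu := pushforward lebesgue_measure phi))//.
move=> _ [[a b] /= _ <-]; rewrite /pushforward/=.
have -> : (fun x : measurableTypeR R => u - x) @^-1` `]a, b] = `[u - b, u - a[%classic.
  by apply/seteqP; split => x /=; rewrite !in_itv/= => /andP[h1 h2];
    apply/andP; split; lra.
rewrite !lebesgue_measure_itv/= !lte_fin ltrD2l ltrN2.
by case: ifPn => // _; rewrite -!EFinB; congr EFin; ring.
Qed.

Lemma integral_reflect (R : realType) (u : R) (f : R -> \bar R) :
  measurable_fun setT f -> (forall x, 0 <= f x)%E ->
  (\int[lebesgue_measure]_x f (u - x)%R = \int[lebesgue_measure]_x f x)%E.
Proof.
move=> mf f0.
have mphi : measurable_fun setT (fun x : measurableTypeR R => u - x : measurableTypeR R).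
  exact: measurable_funB.
rewrite -[LHS](ge0_integral_pushforward mphi lebesgue_measure measurableT mf).
  by apply: eq_measure_integral => A mA _; exact: lebesgue_measure_reflect.
by move=> x _.
Qed.

Section renewal_fixed_point.
Context (R : realType) (psi : R -> R) (lambda : R).
Local Notation mu := (@lebesgue_measure R).
Hypothesis lambda_gt0 : 0 < lambda.
Hypothesis mpsi : measurable_fun setT psi.
Hypothesis psi01 : forall x, 0 <= psi x <= 1.
Hypothesis psi_neg : forall x, x < 0 -> psi x = 1.

(** Up to the factor [lambda], the mean number of batches that arrive before
    time [u] and have a marked customer present at time [u].  As [psi] is 1 on
    negative ages, the integral over a half-line is one over [[0, u]]. *)
Definition marked_mean (u : R) : R := \int[mu]_(y in `]-oo, u]) (1 - psi y).

Let m1psi : measurable_fun setT (fun y => 1 - psi y).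
Proof. exact: measurable_funB. Qed.

Let psi_out u y : y <= u -> `|1 - psi y| <= \1_(`[0, u]) y.
Proof.
move=> yu; have [y0|y0] := ltP y 0; first by rewrite psi_neg// subrr normr0.
rewrite indicE mem_set//= ?in_itv/= ?y0//.
by case/andP: (psi01 y) => p0 p1; rewrite ger0_norm ?subr_ge0// lerBlDr lerDl.
Qed.

Lemma integrable_marked u : mu.-integrable `]-oo, u] (EFin \o (fun y => 1 - psi y)).
Proof.
apply: (@le_integrable _ _ _ mu _ _ _ (EFin \o (\1_(`[0, u]%classic) : R -> R))) => //.
- by apply/measurable_EFinP; exact: measurable_funTS.
- move=> y; rewrite /= in_itv/= => yu; rewrite lee_fin.
  by rewrite [leRHS]ger0_norm//; exact: psi_out.
- exact: integrableS (integrable_indic_itv _ _ _ _).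
Qed.

Lemma marked_mean_ge0 u : 0 <= marked_mean u.
Proof.
by apply: Rintegral_ge0 => y _; case/andP: (psi01 y) => _; rewrite subr_ge0.
Qed.

Lemma marked_mean_neg u : u < 0 -> marked_mean u = 0.
Proof.
move=> u0; rewrite /marked_mean -[RHS](mul0r (fine (mu `]-oo, u]))) -Rintegral_cst//.
apply: eq_Rintegral => y; rewrite inE/= in_itv/= => yu.
by rewrite psi_neg ?subrr// (le_lt_trans yu).
Qed.

Lemma marked_mean_homo : {homo marked_mean : v w / v <= w}.
Proof.
move=> v w vw; rewrite -subr_ge0.
have := @Rintegral_itvB _ _ -oo%O (BRight w) v (integrable_marked w).
rewrite -/(marked_mean w) -/(marked_mean v) => /(_ isT); rewrite bnd_simp => /(_ vw) ->.
by apply: Rintegral_ge0 => y _; case/andP: (psi01 y) => _; rewrite subr_ge0.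
Qed.

Let J u := u - marked_mean u.

Let JE v w : v <= w -> J w - J v = \int[mu]_(y in `]v, w]) psi y.
Proof.
move=> vw.
have ipsi : mu.-integrable `]v, w] (EFin \o psi).
  apply: (@bounded_integrable_oc _ _ 1) => // x _.
  by case/andP: (psi01 x) => p0 p1; rewrite ger0_norm.
have i1 : mu.-integrable `]v, w] (EFin \o cst 1).
  by apply: (@bounded_integrable_oc _ _ 1) => // x _; rewrite normr1.
have := @Rintegral_itvB _ _ -oo%O (BRight w) v (integrable_marked w).
rewrite -/(marked_mean w) -/(marked_mean v) => /(_ isT); rewrite bnd_simp => /(_ vw).
rewrite RintegralB// Rintegral_cst// mul1r [X in fine X](itv_oc_measure vw)/=.
by rewrite /J => h; lra.
Qed.

Let J_le u : J u <= u. Proof. by rewrite /J gerBl marked_mean_ge0. Qed.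

Let mJ : measurable_fun setT J.
Proof.
apply: nondecreasing_measurable => //; exact: (antiderivative_homo mpsi psi01 JE).
Qed.

Let g y := lambda * psi y * expR (lambda * J y).

Let mg : measurable_fun setT g.
Proof.
apply: measurable_funM; first exact: measurable_funM.
by apply: measurableT_comp => //; exact: measurable_funM.
Qed.

Let g_ge0 y : 0 <= g y.
Proof. by case/andP: (psi01 y) => p0 _; rewrite !mulr_ge0 ?expR_ge0// ltW. Qed.

Let pdf_reflect v y : y <= v ->
  exponential_pdf lambda (v - y) = expR (- (lambda * v)) * (lambda * expR (lambda * y)).
Proof.
move=> yv; rewrite exponential_pdfE ?subr_ge0//.
rewrite mulrCA -expRD; congr (_ * expR _); ring.
Qed.

Let pdf_reflect0 v y : v < y -> exponential_pdf lambda (v - y) = 0.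
Proof. by move=> vy; rewrite lt0_exponential_pdf// subr_lt0. Qed.

Let mpdf : measurable_fun setT (EFin \o exponential_pdf lambda).
Proof. by apply/measurable_EFinP; exact: measurable_exponential_pdf. Qed.

Let pdf0 x : (0 <= (exponential_pdf lambda x)%:E)%E.
Proof. by rewrite lee_fin exponential_pdf_ge0// ltW. Qed.

Let g_tail v : (\int[mu]_(y in `]-oo, v]) (g y)%:E <= (expR (lambda * v))%:E)%E.
Proof.
have := integral_exponential_pdf lambda_gt0.
rewrite -(integral_reflect v mpdf pdf0) => h.
rewrite -[leRHS]mule1 -h -ge0_integralZl//; last 2 first.
- exact: (measurableT_comp mpdf (measurable_funB (measurable_cst v) (@measurable_id _ _ _))).
- by move=> y _; exact: pdf0.
rewrite [leLHS]integral_mkcond; apply: (@ge0_le_integral _ _ _ mu) => //.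
- by move=> y _; rewrite patchE; case: ifPn => // _; rewrite lee_fin.
- by apply/measurable_restrict => //; rewrite setTI; apply/measurable_funTS/measurable_EFinP.
- apply: emeasurable_funM => //.
  exact: (measurableT_comp mpdf (measurable_funB (measurable_cst v) (@measurable_id _ _ _))).
move=> y _; rewrite patchE; case: ifPn => [|_]; last first.
  by rewrite mule_ge0 ?pdf0// lee_fin expR_ge0.
rewrite inE/= in_itv/= => yv; rewrite pdf_reflect// -EFinM lee_fin [leRHS]mulrA -expRD.
rewrite subrr expR0 mul1r /g; case/andP: (psi01 y) => p0 p1.
apply: ler_pM; rewrite ?mulr_ge0 ?expR_ge0 ?(ltW lambda_gt0)//.
  by rewrite ler_piMr// ltW.
by rewrite ler_expR ler_pM2l.
Qed.

Let g_integral u : (\int[mu]_(y in `]-oo, u]) (g y)%:E = (expR (lambda * J u))%:E)%E.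
Proof.
have EgE v : v <= u -> (\int[mu]_(y in `]-oo, u]) (g y)%:E =
    \int[mu]_(y in `]-oo, v]) (g y)%:E +
    (expR (lambda * J u) - expR (lambda * J v))%:E)%E.
  move=> vu; rewrite -(expR_antiderivative_integral lambda_gt0 mpsi psi01 JE vu).
  rewrite /Rintegral fineK; last first.
    apply: integrable_fin_num => //.
    apply: (@bounded_integrable_oc _ _ (lambda * expR (lambda * J u))) => //.
    move=> y /andP[_ yu]; rewrite (ger0_norm (g_ge0 y)).
    case/andP: (psi01 y) => p0 p1.
    have l0 := ltW lambda_gt0.
    apply: ler_pM; [exact: mulr_ge0|exact: expR_ge0|by rewrite ler_piMr|].
    rewrite ler_expR ler_pM2l//; exact: (antiderivative_homo mpsi psi01 JE).
  rewrite -ge0_integral_setU//=.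
  - by rewrite -itv_bndbnd_setU// bnd_simp.
  - by apply/measurable_funTS/measurable_EFinP.
  - by move=> y _; rewrite lee_fin.
  - apply/disj_setPS => y [/=]; rewrite !in_itv/= => yv /andP[vy _].
    by have := lt_le_trans vy yv; rewrite ltxx.
have fin : (\int[mu]_(y in `]-oo, u]) (g y)%:E)%E \is a fin_num.
  rewrite ge0_fin_numE; last by apply: integral_ge0 => y _; rewrite lee_fin.
  exact: le_lt_trans (g_tail u) (ltry _).
rewrite -(fineK fin); congr EFin; apply/eqP; rewrite -subr_eq0 -normr_le0.
apply/ler_addgt0Pl => e e0; rewrite addr0.
(* Both sides have the same increments, and at [v] each is at most
   [e^(lambda v) <= e]. *)
pose v := Num.min u (- (e * lambda)^-1).
have vu : v <= u by rewrite ge_min lexx.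
have Kv : expR (lambda * v) <= e.
  apply: le_trans (expRN_div_le e0); rewrite ler_expR.
  apply: (@le_trans _ _ (lambda * - (e * lambda)^-1)).
    by rewrite ler_pM2l// ge_min lexx orbT.
  by rewrite invfM mulrN mulrCA divff ?mulr1// gt_eqF.
have finv : (\int[mu]_(y in `]-oo, v]) (g y)%:E)%E \is a fin_num.
  rewrite ge0_fin_numE; last by apply: integral_ge0 => y _; rewrite lee_fin.
  exact: le_lt_trans (g_tail v) (ltry _).
rewrite (EgE _ vu) -[X in fine (X + _)%E](fineK finv) /=.
have := g_tail v; rewrite -[X in (X <= _)%E](fineK finv) lee_fin.
set W := fine _; have W0 : 0 <= W.
  by rewrite fine_ge0//; apply: integral_ge0 => y _; rewrite lee_fin.
have K0 := expR_ge0 (lambda * J v).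
have K1 : expR (lambda * J v) <= expR (lambda * v) by rewrite ler_expR ler_pM2l.
move=> W1; move: W0 W1 K0 K1 Kv; clearbody W.
move: (expR (lambda * J v)) (expR (lambda * J u)) (expR (lambda * v)) => a b k.
by move=> W0 W1 a0 ak ke; rewrite ler_norml; apply/andP; split; lra.
Qed.

(** Substituting [y = u - x] and multiplying by [e^(lambda u)] turns the equation
    into [int_(-oo)^u lambda psi e^(lambda J) = e^(lambda J u)], where
    [J y = y - marked_mean y] is an indefinite integral of [psi]. *)
Theorem renewal_fixed_point (u : R) :
  (\int[mu]_x ((psi (u - x) * expR (- (lambda * marked_mean (u - x))))%:E *
     (exponential_pdf lambda x)%:E) = (expR (- (lambda * marked_mean u)))%:E)%E.
Proof.
pose F y := ((psi y * expR (- (lambda * marked_mean y)))%:E *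
     (exponential_pdf lambda (u - y))%:E)%E.
transitivity (\int[mu]_x F (u - x)%R)%E.
  by apply: eq_integral => x _; rewrite /F subKr.
have FE y : F y = ((expR (- (lambda * u)))%:E *
    ((fun y => (g y)%:E) \_ `]-oo, u]) y)%E.
  rewrite /F patchE; have [yu|uy] := leP y u.
    rewrite mem_set; last by rewrite /= in_itv.
    rewrite pdf_reflect// -!EFinM /g /J; congr EFin.
    rewrite mulrBr expRD; ring.
  rewrite memNset; last by rewrite /= in_itv/= leNgt uy.
  by rewrite mule0 pdf_reflect0 ?mule0.
have mgr : measurable_fun setT ((fun y => (g y)%:E) \_ `]-oo, u]).
  by apply/measurable_restrict => //; rewrite setTI; apply/measurable_funTS/measurable_EFinP.
have gr0 y : (0 <= ((fun y => (g y)%:E) \_ `]-oo, u]) y)%E.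
  by rewrite patchE; case: ifPn => // _; rewrite lee_fin.
rewrite integral_reflect//; last 2 first.
- by rewrite (funext FE); exact: emeasurable_funM.
- by move=> y; rewrite FE mule_ge0// lee_fin expR_ge0.
under eq_integral do rewrite FE.
rewrite ge0_integralZl//.
rewrite -integral_mkcond g_integral -EFinM -expRD; congr EFin; congr expR.
by rewrite /J; ring.
Qed.

End renewal_fixed_point.

(** * Algebra of Laplace transforms *)

Section laplace_algebra.
Context (R : realType) (s : R).
Hypothesis s0 : 0 < s.

Lemma laplaceE (x : \bar R) : (0 <= x)%E ->
  (laplace s x)%:E = expeR (- (s%:E * x)).
Proof.
move=> x0; rewrite /laplace fineK// ge0_fin_numE ?expeR_ge0//.
case: x x0 => [r|_|]//=; first by rewrite ltry.
by rewrite gt0_muley ?lte_fin//= ltry.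
Qed.

Lemma laplace_ge0 (x : \bar R) : 0 <= laplace s x.
Proof. by rewrite /laplace fine_ge0// expeR_ge0. Qed.

Lemma laplace_le1 (x : \bar R) : (0 <= x)%E -> laplace s x <= 1.
Proof.
case: x => [r r0|_|]//=; last by rewrite laplace_pinfty.
by rewrite laplace_fin -expR0 ler_expR oppr_le0 mulr_ge0// ltW.
Qed.

Lemma laplace_homo (x y : \bar R) : (0 <= x)%E -> (x <= y)%E ->
  laplace s y <= laplace s x.
Proof.
case: x => [x x0|_|//]; case: y => [y xy|_|//] //.
- by rewrite !laplace_fin ler_expR lerN2 ler_pM2l.
- by rewrite laplace_pinfty// laplace_ge0.
Qed.

Lemma laplace0 : laplace s 0%E = 1.
Proof. by rewrite laplace_fin mulr0 oppr0 expR0. Qed.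

Lemma laplaceD (x y : \bar R) : (0 <= x)%E -> (0 <= y)%E ->
  laplace s (x + y)%E = laplace s x * laplace s y.
Proof.
move=> x0 y0; apply: EFin_inj; rewrite EFinM !laplaceE// ?adde_ge0//.
rewrite ge0_muleDr// oppeD ?expeRD//.
by rewrite ge0_adde_def// inE mule_ge0// lee_fin ltW.
Qed.

Lemma laplace_sum (I : Type) (r : seq I) (Q : pred I) (u : I -> \bar R) :
  (forall i, Q i -> 0 <= u i)%E ->
  laplace s (\sum_(i <- r | Q i) u i)%E = \prod_(i <- r | Q i) laplace s (u i).
Proof.
move=> u0; elim: r => [|i r IH]; first by rewrite !big_nil laplace0.
by rewrite !big_cons; case: ifP => // Qi; rewrite laplaceD ?IH ?u0// sume_ge0.
Qed.

(** At an infinite limit the transforms tend to 0, which is the value there. *)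
Lemma laplace_cvg (u : nat -> \bar R) (l : \bar R) : (forall m, 0 <= u m)%E ->
  u m @[m --> \oo] --> l -> laplace s (u m) @[m --> \oo] --> laplace s l.
Proof.
move=> u0 ul; have l0 : (0 <= l)%E by apply: (cvge_ge _ ul); apply: nearW.
case: l l0 ul => [r r0|_|]// ul.
- have /fine_cvgP[ufin ur] := ul.
  have cr : expR (- (s * fine (u m))) @[m --> \oo] --> expR (- (s * r)).
    apply: continuous_cvg; first exact: continuous_expR.
    by apply: cvgN; apply: cvgMr.
  rewrite laplace_fin; apply: cvg_trans cr; apply: near_eq_cvg.
  by near=> m; rewrite -laplace_fin fineK//; near: m.
- rewrite laplace_pinfty//; apply/cvgrPdist_le => e e0.
  have ue : \forall m \near \oo, (((e * s)^-1)%:E <= u m)%E by exact: cvgey_ge.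
  near=> m; have : (((e * s)^-1)%:E <= u m)%E by near: m.
  rewrite sub0r normrN (ger0_norm (laplace_ge0 _)).
  case: (u m) (u0 m) => [r r0|_|]// rs; last by rewrite laplace_pinfty ?ltW.
  rewrite laplace_fin; apply: le_trans (expRN_div_le e0).
  rewrite ler_expR lerN2 -ler_pdivrMl// -invfM mulrC//.
Unshelve. all: by end_near.
Qed.

Lemma measurable_laplace d (T : measurableType d) (X : T -> \bar R) :
  measurable_fun setT X -> (forall w, extended_nat (X w)) ->
  measurable_fun setT (fun w => laplace s (X w)).
Proof. by move=> mX eX; exact: (measurable_extended_nat_comp mX eX). Qed.

End laplace_algebra.

Section extended_nat_sums.
Context (R : realType).

Lemma extended_nat_ge0 (x : \bar R) : extended_nat x -> (0 <= x)%E.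
Proof. by move=> [[k _ <-]|->]; rewrite ?lee_fin// leey. Qed.

Lemma extended_natD (x y : \bar R) :
  extended_nat x -> extended_nat y -> extended_nat (x + y)%E.
Proof.
move=> [[k _ <-]|->]; last first.
  by move=> /extended_nat_ge0 y0; right; rewrite /= addye// gt_eqF// (lt_le_trans _ y0).
move=> [[l _ <-]|->]; last by right; rewrite /= addey.
by left; exists (k + l)%N => //; rewrite natrD.
Qed.

Lemma extended_natM (n : nat) (x : \bar R) :
  extended_nat x -> extended_nat (n%:R%:E * x)%E.
Proof.
move=> [[k _ <-]|->]; first by left; exists (n * k)%N => //; rewrite natrM.
case: n => [|n]; first by left; exists 0%N; rewrite ?mul0e.
by right; rewrite /= gt0_muley// lte_fin.
Qed.

Lemma extended_nat_sum (I : Type) (r : seq I) (Q : pred I) (u : I -> \bar R) :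
  (forall i, Q i -> extended_nat (u i)) -> extended_nat (\sum_(i <- r | Q i) u i)%E.
Proof.
move=> eu; apply: (big_ind (@extended_nat R)) => //; first by left; exists 0%N.
exact: extended_natD.
Qed.

(** A series of integers with a finite sum has partial sums that are eventually
    within [1/2] of it, hence eventually constant. *)
Lemma extended_nat_nneseries (m : nat) (u : nat -> \bar R) :
  (forall i, (m <= i)%N -> extended_nat (u i)) ->
  extended_nat (\sum_(m <= i <oo) u i)%E.
Proof.
move=> eu.
pose S n := (\sum_(m <= i < n) u i)%E.
have eS n : extended_nat (S n).
  rewrite /S big_seq_cond; apply: extended_nat_sum => i.
  by rewrite mem_index_iota andbT => /andP[/eu].
have u0 i : (m <= i)%N -> (0 <= u i)%E by move=> /eu/extended_nat_ge0.
have ndS : {homo S : a b / (a <= b)%N >-> (a <= b)%E}.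
  by apply: ereal_nondecreasing_series => i mi _; exact: u0.
have cS : S n @[n --> \oo] --> (\sum_(m <= i <oo) u i)%E.
  by apply: is_cvg_nneseries => i mi _; exact: u0.
set L := (\sum_(m <= i <oo) u i)%E in cS *.
have SL n : (S n <= L)%E.
  by apply: nneseries_lim_ge => i mi _; exact: u0.
have [Loo|Lfin] := eqVneq L +oo%E; first by right.
have Lf : L \is a fin_num.
  rewrite ge0_fin_numE ?lt_neqAle ?Lfin ?leey//.
  exact: le_trans (extended_nat_ge0 (eS 0%N)) (SL _).
have fS : (fine \o S) @ \oo --> fine L by apply: fine_cvg; rewrite fineK.
have /cvgrPdist_lt/(_ (1 / 2))[|N _ SN] := fS; first by rewrite divr_gt0.
have SE n : (N <= n)%N -> S n = S N.
  move=> Nn; have := SN _ Nn; have := SN _ (leqnn N); rewrite /=.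
  have := SL n; have := SL N.
  case: (eS n) => [[k _ <-]|->]; last first.
    by move=> _; rewrite leye_eq => /eqP Loo; rewrite Loo eqxx in Lfin.
  case: (eS N) => [[l _ <-]|-> +]; last first.
    by rewrite leye_eq => /eqP Loo; rewrite Loo eqxx in Lfin.
  move=> _ _ /= lN kn.
  have : `|k%:R - l%:R : R| < 1.
    rewrite -(subrK (fine L) (k%:R)) -addrA.
    apply: (le_lt_trans (ler_normD _ _)).
    by rewrite [X in X + _]distrC [ltRHS](splitr 1) ltrD.
  have [-> //|kl] := eqVneq k l.
  have : 1 <= `|k%:Z - l%:Z| by rewrite -gtz0_ge1 normr_gt0 subr_eq0.
  by rewrite -(ler_int R) intr_norm rmorphB/= leNgt => /negP.
suff -> : L = S N by exact: eS.
have cS2 : S n @[n --> \oo] --> S N.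
  by apply: cvg_near_cst; exists N => // n /= Nn; rewrite SE.
by rewrite -(cvg_lim _ cS)// (cvg_lim _ cS2).
Qed.

End extended_nat_sums.

(** * The transform of the number in system *)

(** Split the space according to the value of the index. *)
Lemma measurable_fun_nat_index d d' (T : measurableType d) (Y : measurableType d')
    (n : T -> nat) (F : nat -> T -> Y) :
  measurable_fun setT n -> (forall k, measurable_fun setT (F k)) ->
  measurable_fun setT (fun w => F (n w) w).
Proof.
move=> mn mF _ A mA; rewrite setTI.
have -> : (fun w => F (n w) w) @^-1` A =
    \bigcup_k (n @^-1` [set k] `&` F k @^-1` A).
  apply/seteqP; split => [w /= FA|w [k _ /= [-> //]]].
  by exists (n w).
apply: bigcupT_measurable => k; apply: measurableI.
  by rewrite -[_ @^-1` _]setTI; exact: mn.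
by rewrite -[_ @^-1` _]setTI; exact: mF.
Qed.

Lemma measurable_count_in_service d (T : measurableType d) (R : realType)
    (u : T -> R) (n : T -> nat) (S : nat -> T -> R) :
  measurable_fun setT u -> measurable_fun setT n ->
  (forall k, measurable_fun setT (S k)) ->
  measurable_fun setT (fun x =>
    ((\sum_(0 <= k < n x) ((0 <= u x < S k x)%R : nat))%N%:R : R)).
Proof.
move=> mu mn mS.
apply: (measurable_fun_nat_index
  (F := fun m x => ((\sum_(0 <= k < m) ((0 <= u x < S k x)%R : nat))%N%:R : R))) => // m.
under eq_fun do rewrite natr_sum.
apply: measurable_sum => k.
rewrite (_ : (fun x => _) = (fun x => if 0 <= u x < S k x then 1 else 0 : R)).
  apply: measurable_fun_ifT => //; apply: measurable_and.
    exact: measurable_fun_ler.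
  exact: measurable_fun_ltr.
by apply/funext => x; case: ifP.
Qed.

Lemma measurable_fun_mem d (T : measurableType d) (A : set T) : measurable A ->
  measurable_fun setT (fun x => x \in A).
Proof.
move=> mA; apply: (measurable_fun_bool true); rewrite setTI.
rewrite (_ : _ @^-1` _ = A)//; by apply/seteqP; split => x /=; [exact: set_mem|exact: mem_set].
Qed.

Lemma integral_two_valued d (T : measurableType d) (R : realType)
    (P : probability T R) (A : set T) (z : R) : measurable A -> 0 <= z ->
  (\int[P]_w (if w \in A then z else 1)%:E = (1 - (1 - z) * fine (P A))%:E)%E.
Proof.
move=> mA z0.
transitivity (\int[P]_w ((z * \1_A w)%:E + (\1_(~` A) w)%:E))%E.
  apply: eq_integral => w _; rewrite -EFinD !indicE in_setC.
  by case: (w \in A); rewrite /= ?mulr1 ?mulr0 ?addr0 ?add0r.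
have mI B : measurable B -> measurable_fun setT (EFin \o (\1_B : T -> R)).
  by move=> mB; apply/measurable_EFinP; exact: measurable_indic.
have mAC := measurableC mA.
have I0 B (w : T) : setT w -> (0 <= (\1_B w : R)%:E)%E by rewrite lee_fin.
rewrite ge0_integralD//; last 3 first.
- by move=> w _; rewrite lee_fin mulr_ge0.
- by apply/measurable_EFinP; apply: measurable_funM => //; exact: measurable_indic.
- exact: mI.
under eq_integral do rewrite EFinM.
rewrite ge0_integralZl//; last exact: mI.
rewrite !integral_indic// !setIT [X in (_ + X)%E](probability_setC P mA).
have PAf := fin_num_measure P _ mA.
rewrite -[X in (z%:E * X)%E](fineK PAf) -[X in (1 - X)%E](fineK PAf).
by rewrite -EFinB -EFinM -EFinD; congr EFin; ring.
Qed.

Section queue.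
Context (R : realType) (lambda : R) (G : probability R R)
  (d : measure_display) (T : measurableType d) (P : probability T R)
  (tau : nat -> {RV P >-> R}) (N : nat -> {RV P >-> nat})
  (serv : nat -> nat -> {RV P >-> R}).
Hypothesis lambda_gt0 : 0 < lambda.
Hypothesis queue : batch_arrival_queue lambda G tau N serv.

Local Notation prim := (primitive_sigma tau N serv).

Lemma measurable_gap i : measurable_fun setT (gap tau i).
Proof. by case: i => [|i] /=; [exact: measurable_funP|exact: measurable_funB]. Qed.

Lemma primitive_setI x : setI_closed (prim x).
Proof. by case: x => [[i|i]|[i k]]; exact: sigma_rv_setI_closed. Qed.

Lemma primitive_setT x : prim x setT.
Proof. by case: x => [[i|i]|[i k]]; exact: sigma_rv_setT. Qed.

Lemma primitive_measurable x : prim x `<=` measurable.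
Proof.
case: x => [[i|i]|[i k]]; apply: sigma_rv_measurable => //.
exact: measurable_gap.
Qed.

Local Notation sub D := (subsigma prim D).

Lemma gap_sub (D : set (nat + nat + nat * nat)) i : D (inl (inl i)) ->
  measurable_fun setT (gap tau i : sub D -> R).
Proof. by move=> Di; exact: measurable_subsigma_rv Di _. Qed.

Lemma batch_sub (D : set (nat + nat + nat * nat)) i : D (inl (inr i)) ->
  measurable_fun setT (N i : sub D -> nat).
Proof. by move=> Di; exact: measurable_subsigma_rv Di _. Qed.

Lemma service_sub (D : set (nat + nat + nat * nat)) i k : D (inr (i, k)) ->
  measurable_fun setT (serv i k : sub D -> R).
Proof. by move=> Di; exact: measurable_subsigma_rv Di _. Qed.

(** The time of the [m]-th arrival when the start of the process counts as
    number 0; hence the shift by one in [epochS]. *)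
Definition epoch (m : nat) (w : T) : R := \sum_(i < m) gap tau i w.

(** The sum of the gaps telescopes. *)
Lemma epochS m w : epoch m.+1 w = tau m w.
Proof.
elim: m => [|m IH]; first by rewrite /epoch big_ord1.
by rewrite /epoch big_ord_recr/= -/(epoch m.+1 w) IH addrC subrK.
Qed.

Lemma epoch_sub (D : set (nat + nat + nat * nat)) m :
  (forall i, (i < m)%N -> D (inl (inl i))) ->
  measurable_fun setT (epoch m : sub D -> R).
Proof.
move=> Dm.
rewrite (_ : epoch m = (fun w =>
    \sum_(i < m | true) (fun i => if (i < m)%N then gap tau i w else 0) i)); last first.
  by apply/funext => w; apply: eq_bigr => i _; rewrite ltn_ord.
apply: measurable_sum => i; rewrite ltn_ord; apply: gap_sub; exact: Dm.
Qed.

(** The customers of batch [i] still in service at age [u].  The condition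
    [0 <= u] makes batches of the future count for nothing. *)
Definition batch_load i (u : R) (w : T) : nat :=
  \sum_(0 <= k < N i w) ((0 <= u < serv i k w)%R : nat).

Variable s : R.
Hypothesis s_gt0 : 0 < s.

(** The probability, given the size and services of batch [i], that none of its
    customers in service at age [u] is marked. *)
Definition batch_weight i (u : R) (w : T) : R := expR (- (s * (batch_load i u w)%:R)).

Lemma batch_weight_ge0 i u w : 0 <= batch_weight i u w.
Proof. exact: expR_ge0. Qed.

Lemma batch_weight_le1 i u w : batch_weight i u w <= 1.
Proof. by rewrite -expR0 ler_expR oppr_le0 mulr_ge0// ltW. Qed.

Lemma batch_weight_neg i u w : u < 0 -> batch_weight i u w = 1.
Proof.
move=> u0; rewrite /batch_weight /batch_load big1 ?mulr0 ?oppr0 ?expR0// => k _.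
by rewrite leNgt u0.
Qed.

Lemma measurable_batch_weight d' (T' : measurableType d') i (u : T' -> R) (v : T' -> T) :
  measurable_fun setT u -> measurable_fun setT (N i \o v) ->
  (forall k, measurable_fun setT (serv i k \o v)) ->
  measurable_fun setT (fun x => batch_weight i (u x) (v x)).
Proof.
move=> mu mN mS; apply: measurableT_comp => //; apply: measurableT_comp => //.
apply: measurable_funM => //.
exact: (measurable_count_in_service mu mN mS).
Qed.

Lemma batch_weight_sub (D : set (nat + nat + nat * nat)) d' (T' : measurableType d')
    i (u : T' -> R) (v : T' -> T) :
  D (inl (inr i)) -> (forall k, D (inr (i, k))) ->
  measurable_fun setT u -> measurable_fun setT (v : T' -> sub D) ->
  measurable_fun setT (fun x => batch_weight i (u x) (v x)).
Proof.
move=> DN DS mu mv; apply: measurable_batch_weight => //.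
  exact: (measurableT_comp (batch_sub DN) mv).
by move=> k; exact: (measurableT_comp (service_sub (DS k)) mv).
Qed.

(** The probability that a customer of age [u] is absent or unmarked. *)
Definition unmarked_service (u : R) : R :=
  1 - (1 - expR (- s)) * fine (G [set x | 0 <= u < x]).

Lemma measurable_in_service u : measurable [set x : R | 0 <= u < x].
Proof.
have [u0|u0] := leP 0 u.
  rewrite (_ : [set x | _] = `]u, +oo[%classic)//.
  by apply/seteqP; split => x; rewrite /= in_itv/= andbT.
by rewrite (_ : [set x | _] = set0)//; apply/seteqP; split.
Qed.

(** Given the batch size, the customers contribute independent factors with
    mean [unmarked_service u]. *)
Lemma batch_weight_expectation i u :
  (\int[P]_w (batch_weight i u w)%:E =
   \sum_(0 <= n <oo) P (N 0%N @^-1` [set n]) * (unmarked_service u ^+ n)%:E)%E.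
Proof.
have mNn n : measurable (N i @^-1` [set n]).
  by rewrite -[_ @^-1` _]setTI; exact: measurable_funP.
have mB : measurable_fun setT (EFin \o batch_weight i u).
  apply/measurable_EFinP; exact: (measurable_batch_weight (v := id)).
have -> : [set: T] = \bigcup_n (N i @^-1` [set n]).
  by apply/seteqP; split => // w _; exists (N i w).
rewrite ge0_integral_bigcup//; last 3 first.
- by apply: measurable_funTS.
- by move=> w _; rewrite lee_fin batch_weight_ge0.
- by move=> m n _ _ [w [/= <- <-]].
apply: eq_eseriesr => n _.
pose f (x : nat + nat + nat * nat) (w : T) : \bar R :=
  match x with
  | inl _ => (\1_(N i @^-1` [set n]) w)%:E
  | inr (j, k) => (if w \in serv j k @^-1` [set x | 0 <= u < x] then expR (- s) else 1)%:E
  end.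
(* On the event that the batch has size [n], its weight is a product over its size
   and its first [n] services. *)
pose r : seq (nat + nat + nat * nat) := inl (inr i) :: [seq inr (i, k) | k <- iota 0 n].
have mSA k : measurable (serv i k @^-1` [set x | 0 <= u < x]).
  by rewrite -[_ @^-1` _]setTI; apply: measurable_funP => //; exact: measurable_in_service.
transitivity (\int[P]_w \prod_(x <- r) f x w)%E.
  rewrite [LHS]integral_mkcond; apply: eq_integral => w _.
  rewrite /r big_cons /= big_map patchE indicE.
  case: ifPn => [|_]; last by rewrite mul0e.
  rewrite inE /= => Nw; rewrite mul1e /batch_weight /batch_load Nw natr_sum mulr_sumr.
  rewrite -sumrN expR_sum -prodEFin /index_iota subn0; apply: eq_bigr => k _.
  rewrite /=; congr EFin; case: ifPn => [|/negP].
    by rewrite inE/= => ->; rewrite mulr1.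
  by rewrite inE/= => /negP/negbTE ->; rewrite mulr0 oppr0 expR0.
rewrite (subsigma_integral_prod primitive_setI primitive_setT primitive_measurable
  (primitives_independent queue))//; last 3 first.
- rewrite /= map_inj_uniq ?iota_uniq ?andbT; last by move=> ? ? [].
  by apply/mapP => -[].
- move=> x; rewrite inE => /predU1P[->|/mapP[k _ ->]].
    apply/measurable_EFinP.
    exact: (measurableT_comp (@measurable_indic _ _ _ _ [set n] _) (batch_sub _)).
  apply/measurable_EFinP.
  have mg : measurable_fun setT (fun x : R =>
      if x \in [set x | 0 <= u < x] then expR (- s) else 1).
    apply: measurable_fun_ifT => //.
    exact: measurable_fun_mem (measurable_in_service u).
  exact: (measurableT_comp mg (service_sub _)).
- by move=> [x|[j k]] w /=; rewrite lee_fin// ; case: ifPn; rewrite ?expR_ge0.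
rewrite /r big_cons big_map /= integral_indic// setIT; congr (_ * _)%E.
  have mn : measurable [set n] by [].
  exact: (batch_law queue i mn).
transitivity (\prod_(k <- iota 0 n) (unmarked_service u)%:E)%E.
  apply: eq_bigr => k _; rewrite integral_two_valued ?expR_ge0//.
  have := service_law queue i k (measurable_in_service u).
  by rewrite /unmarked_service => ->.
by rewrite prodEFin big_const_seq count_predT size_iota iter_mulr_1.
Qed.

(** The function called [psi] in the renewal equation.  The batches are
    identically distributed, so batch 0 represents them all. *)
Definition unmarked_prob (u : R) : R := fine (\int[P]_w (batch_weight 0%N u w)%:E).

Lemma unmarked_probE i u : (\int[P]_w (batch_weight i u w)%:E = (unmarked_prob u)%:E)%E.
Proof.
rewrite /unmarked_prob batch_weight_expectation -(batch_weight_expectation 0%N) fineK//.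
rewrite ge0_fin_numE; last by apply: integral_ge0 => w _; rewrite lee_fin batch_weight_ge0.
apply: (@le_lt_trans _ _ (\int[P]_w 1)%E).
  apply: ge0_le_integral => //.
  - by move=> w _; rewrite lee_fin batch_weight_ge0.
  - by apply/measurable_EFinP; exact: (measurable_batch_weight (v := id)).
  - by move=> w _; rewrite lee_fin batch_weight_le1.
by rewrite integral_cst// mul1e [X in (X < _)%E](probability_setT P) ltry.
Qed.

Lemma unmarked_prob01 u : 0 <= unmarked_prob u <= 1.
Proof.
apply/andP; split; rewrite -lee_fin -(unmarked_probE 0).
  by apply: integral_ge0 => w _; rewrite lee_fin batch_weight_ge0.
have -> : (1%:E = \int[P]_w 1)%E.
  by rewrite integral_cst// mul1e [RHS](probability_setT P).
apply: ge0_le_integral => //.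
- by move=> w _; rewrite lee_fin batch_weight_ge0.
- by apply/measurable_EFinP; exact: (measurable_batch_weight (v := id)).
- by move=> w _; rewrite lee_fin batch_weight_le1.
Qed.

Lemma unmarked_prob_neg u : u < 0 -> unmarked_prob u = 1.
Proof.
move=> u0; apply: EFin_inj; rewrite -(unmarked_probE 0).
under eq_integral do rewrite batch_weight_neg//.
by rewrite integral_cst// mul1e [LHS](probability_setT P).
Qed.

Lemma measurable_unmarked_prob : measurable_fun setT unmarked_prob.
Proof.
have mB : measurable_fun setT (fun x : R * T => (batch_weight 0%N x.1 x.2)%:E).
  apply/measurable_EFinP; apply: measurable_batch_weight => //.
  - exact: measurableT_comp.
  - by move=> k; exact: measurableT_comp.
apply/measurable_EFinP.
rewrite (_ : EFin \o unmarked_prob = fubini_F P (fun x : R * T => (batch_weight 0%N x.1 x.2)%:E)).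
  by apply: measurable_fun_fubini_tonelli_F => // x; rewrite lee_fin batch_weight_ge0.
by apply/funext => u; rewrite /fubini_F/= -(unmarked_probE 0).
Qed.

Definition past_primitives (m : nat) : set (nat + nat + nat * nat) :=
  [set x | match x with
           | inl (inl i) | inl (inr i) | inr (i, _) => (i < m)%N
           end].

Definition batch_primitives (m : nat) : set (nat + nat + nat * nat) :=
  [set x | match x with
           | inl (inl _) => False
           | inl (inr i) | inr (i, _) => i = m
           end].

(** The conditional probability that the first [m] batches have no marked
    customer present at time [t]. *)
Definition past_weight (m : nat) (t : R) (w : T) : R :=
  \prod_(i < m) batch_weight i (t - tau i w) w.

Lemma past_weight_ge0 m t w : 0 <= past_weight m t w.
Proof. by apply: prodr_ge0 => i _; exact: batch_weight_ge0. Qed.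

Lemma past_weight_le1 m t w : past_weight m t w <= 1.
Proof.
by apply: prodr_ile1 => i _; rewrite batch_weight_ge0 batch_weight_le1.
Qed.

Lemma past_weight_sub (D : set (nat + nat + nat * nat)) m t : past_primitives m `<=` D ->
  measurable_fun setT (past_weight m t : sub D -> R).
Proof.
move=> Dm; apply: measurable_prod => i _.
have im := ltn_ord i.
apply: (@batch_weight_sub D _ (sub D) i (fun w => t - tau i w) id) => //.
- exact: Dm.
- by move=> k; exact: Dm.
apply: measurable_funB => //.
rewrite (_ : (tau i : T -> R) = epoch i.+1); last first.
  by apply/funext => w; rewrite epochS.
by apply: epoch_sub => j ji; apply: Dm; exact: leq_trans im.
Qed.

(** The size and the services of batch [m] are independent of everything that
    determines its epoch and the earlier batches. *)
Lemma integrate_batch m t (h : R -> R) : measurable_fun setT h -> (forall u, 0 <= h u) ->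
  (\int[P]_w (past_weight m.+1 t w * h (t - tau m w))%:E =
   \int[P]_w (past_weight m t w * (unmarked_prob (t - tau m w) * h (t - tau m w)))%:E)%E.
Proof.
move=> mh h0.
(* The epoch of batch [m] involves the gap [m] as well as the past. *)
pose D := past_primitives m `|` [set inl (inl m)].
have mtau : measurable_fun setT (tau m : sub D -> R).
  rewrite (_ : (tau m : T -> R) = epoch m.+1); last first.
    by apply/funext => w; rewrite epochS.
  apply: epoch_sub => i; rewrite ltnS leq_eqVlt => /predU1P[->|im]; first by right.
  by left.
pose f (x : T * T) := ((past_weight m t x.1 * h (t - tau m x.1))%:E *
   (batch_weight m (t - tau m x.1) x.2)%:E)%E.
transitivity (\int[P]_w f (w, w))%E.
  apply: eq_integral => w _; rewrite /f -EFinM; congr EFin.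
  by rewrite /past_weight big_ord_recr/=; ring.
have dis : [disjoint D & batch_primitives m].
  by apply/disj_setPS => -[[i|i]|[i k]] [[/=|/=]] // + mi; rewrite ?mi ?ltnn.
have f0 x : (0 <= f x)%E.
  by rewrite mule_ge0// lee_fin ?batch_weight_ge0// mulr_ge0// past_weight_ge0.
have mf : measurable_fun setT (f : sub D * sub (batch_primitives m) -> \bar R).
  have mtau1 : measurable_fun setT (fun x : sub D * sub (batch_primitives m) => t - tau m x.1).
    by apply: measurable_funB => //; exact: (measurableT_comp mtau measurable_fst).
  apply: emeasurable_funM; apply/measurable_EFinP.
    apply: measurable_funM; last exact: (measurableT_comp mh mtau1).
    apply: (measurableT_comp (past_weight_sub _ _) measurable_fst).
    by move=> x px; left.
  apply: (@batch_weight_sub (batch_primitives m) _ (sub D * sub (batch_primitives m))%type m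
    (fun x => t - tau m x.1) snd) => //; exact: measurable_snd.
rewrite (subsigma_integral primitive_setI primitive_setT primitive_measurable
  (primitives_independent queue) (D := D) (D' := batch_primitives m))//.
apply: eq_integral => w _; rewrite /f/= ge0_integralZl//; last 3 first.
- by apply/measurable_EFinP; exact: (measurable_batch_weight (v := id)).
- by move=> x _; rewrite lee_fin batch_weight_ge0.
- by rewrite lee_fin mulr_ge0// past_weight_ge0.
by rewrite unmarked_probE -EFinM; congr EFin; ring.
Qed.

Lemma gap_integral m (f : R -> \bar R) : measurable_fun setT f ->
  (forall x, 0 <= f x)%E ->
  (\int[P]_w f (gap tau m w) =
   \int[lebesgue_measure]_x (f x * (exponential_pdf lambda x)%:E))%E.
Proof.
move=> mf f0.
have mgap : measurable_fun setT (gap tau m : T -> measurableTypeR R).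
  exact: measurable_gap.
have mf' : measurable_fun setT (f : measurableTypeR R -> \bar R) by exact: mf.
pose U : {mfun T >-> measurableTypeR R} := HB.pack (gap tau m : T -> measurableTypeR R)
  (isMeasurableFun.Build _ _ _ _ _ mgap).
rewrite -(ge0_integral_distribution (P := P) U mf' f0).
apply: ge0_integral_density => //.
- exact: measurable_exponential_pdf.
- by move=> x; rewrite exponential_pdf_ge0// ltW.
- by move=> A mA; exact: (gap_law queue m mA).
Qed.

(** The gap that ends at epoch [m] is independent of the first [m] batches. *)
Lemma integrate_gap m t (k : R -> R) : measurable_fun setT k -> (forall u, 0 <= k u) ->
  (\int[P]_w (past_weight m t w * k (t - tau m w))%:E =
   \int[P]_w ((past_weight m t w)%:E *
     \int[lebesgue_measure]_x ((k (t - epoch m w - x)%R)%:E * (exponential_pdf lambda x)%:E)))%E.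
Proof.
move=> mk k0.
pose D' : set (nat + nat + nat * nat) := [set inl (inl m)].
pose f (x : T * T) := ((past_weight m t x.1)%:E *
   (k (t - epoch m x.1 - gap tau m x.2))%:E)%E.
transitivity (\int[P]_w f (w, w))%E.
  apply: eq_integral => w _; rewrite /f -EFinM; congr (_ * k _)%:E.
  by rewrite -epochS /epoch big_ord_recr/= opprD addrA.
have dis : [disjoint past_primitives m & D'].
  by apply/disj_setPS => -[[i|i]|[i j]] [/= im] // [mi]; rewrite mi ltnn in im.
have f0 x : (0 <= f x)%E by rewrite mule_ge0// lee_fin ?past_weight_ge0.
have mf : measurable_fun setT (f : sub (past_primitives m) * sub D' -> \bar R).
  apply: emeasurable_funM; apply/measurable_EFinP.
    exact: (measurableT_comp (past_weight_sub _ _) measurable_fst).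
  apply: (measurableT_comp mk); apply: measurable_funB; last first.
    by apply: (measurableT_comp (gap_sub _) measurable_snd).
  apply: measurable_funB => //.
  by apply: (measurableT_comp (epoch_sub _) measurable_fst).
rewrite (subsigma_integral primitive_setI primitive_setT primitive_measurable
  (primitives_independent queue) (D := past_primitives m) (D' := D'))//.
apply: eq_integral => w _; rewrite /f/=.
have mkw : measurable_fun setT (fun x : R => (k (t - epoch m w - x))%:E).
  by apply/measurable_EFinP; apply: measurableT_comp => //; exact: measurable_funB.
rewrite ge0_integralZl//; last 3 first.
- exact: (measurableT_comp mkw (measurable_gap m)).
- by move=> x _; rewrite lee_fin.
- by rewrite lee_fin past_weight_ge0.
by congr (_ * _)%E; apply: (gap_integral m mkw) => x; rewrite lee_fin.
Qed.

(** The solution [H] of the renewal equation; [queue_laplace] identifies it as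
    the probability that no marked customer is present. *)
Definition void_prob (u : R) : R := expR (- (lambda * marked_mean unmarked_prob u)).

Lemma measurable_void_prob : measurable_fun setT void_prob.
Proof.
apply: measurableT_comp => //; apply: measurableT_comp => //.
apply: measurable_funM => //; apply: nondecreasing_measurable => //.
exact: (marked_mean_homo measurable_unmarked_prob unmarked_prob01 unmarked_prob_neg).
Qed.

Lemma void_prob_le1 u : void_prob u <= 1.
Proof.
rewrite -expR0 ler_expR oppr_le0 mulr_ge0 ?(ltW lambda_gt0)//.
by apply: marked_mean_ge0; exact: unmarked_prob01.
Qed.

(** Averaging over batch [m], and then over the gap before it, amounts to
    evaluating the right-hand side of the renewal equation at [t - epoch m]. *)
Lemma void_prob_martingale m t :
  (\int[P]_w (past_weight m t w * void_prob (t - epoch m w))%:E = (void_prob t)%:E)%E.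
Proof.
have ms := measurable_void_prob.
have s0 u : 0 <= void_prob u by exact: expR_ge0.
elim: m => [|m IH].
  rewrite (eq_integral (fun=> (void_prob t)%:E)) => [|w _]; last first.
    by rewrite /past_weight /epoch !big_ord0 mul1r subr0.
  by rewrite integral_cst// [X in (_ * X)%E](probability_setT P) mule1.
under eq_integral do rewrite epochS.
have mks : measurable_fun setT (fun u => unmarked_prob u * void_prob u).
  by apply: measurable_funM => //; exact: measurable_unmarked_prob.
have ks0 u : 0 <= unmarked_prob u * void_prob u.
  by case/andP: (unmarked_prob01 u) => k0 _; rewrite mulr_ge0.
rewrite integrate_batch//.
apply: (eq_trans (integrate_gap m t mks ks0)).
rewrite -IH; apply: eq_integral => w _.
by rewrite (renewal_fixed_point lambda_gt0 measurable_unmarked_prob unmarked_prob01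
  unmarked_prob_neg).
Qed.

Definition gap_transform : R := lambda / (lambda + 1).

Lemma gap_laplace i : (\int[P]_w (expR (- gap tau i w))%:E = gap_transform%:E)%E.
Proof.
have l1 : 0 < lambda + 1 by rewrite addr_gt0.
rewrite (gap_integral i (f := fun x => (expR (- x))%:E)); last 2 first.
- by apply/measurable_EFinP; apply: measurableT_comp => //; exact: measurable_funN.
- by move=> x; rewrite lee_fin expR_ge0.
have mpdf : measurable_fun setT (EFin \o exponential_pdf (lambda + 1)).
  by apply/measurable_EFinP; exact: measurable_exponential_pdf.
transitivity (\int[lebesgue_measure]_x
    (gap_transform%:E * (exponential_pdf (lambda + 1) x)%:E))%E.
  apply: eq_integral => x _; rewrite -!EFinM; congr EFin.
  have [x0|x0] := ltP x 0; first by rewrite !lt0_exponential_pdf// !mulr0.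
  rewrite !exponential_pdfE// mulrCA -expRD /gap_transform mulrA divfK ?gt_eqF//.
  by congr (_ * expR _); ring.
rewrite ge0_integralZl//.
- by rewrite integral_exponential_pdf// mule1.
- by move=> x _; rewrite lee_fin exponential_pdf_ge0// ltW.
- by rewrite lee_fin divr_ge0// ltW.
Qed.

Lemma epoch_laplace m :
  (\int[P]_w (expR (- epoch m w))%:E = (gap_transform ^+ m)%:E)%E.
Proof.
pose f (x : nat + nat + nat * nat) (w : T) : \bar R :=
  if x is inl (inl i) then (expR (- gap tau i w))%:E else 1%E.
pose r : seq (nat + nat + nat * nat) := [seq inl (inl i) | i <- iota 0 m].
transitivity (\int[P]_w \prod_(x <- r) f x w)%E.
  apply: eq_integral => w _; rewrite /r big_map /= prodEFin -expR_sum sumrN.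
  by rewrite /epoch -(big_mkord xpredT (fun i => gap tau i w)) /index_iota subn0.
rewrite (subsigma_integral_prod primitive_setI primitive_setT primitive_measurable
  (primitives_independent queue))//; last 3 first.
- by rewrite map_inj_uniq ?iota_uniq// => ? ? [].
- move=> x /mapP[i _ ->]; apply/measurable_EFinP; apply: measurableT_comp => //.
  by apply: measurable_funN; exact: gap_sub.
- by move=> [[i|i]|x] w //=; rewrite lee_fin expR_ge0.
rewrite /r big_map /=; under eq_bigr do rewrite gap_laplace.
by rewrite prodEFin big_const_seq count_predT size_iota iter_mulr_1.
Qed.

Lemma measurable_epoch m : measurable_fun setT (epoch m).
Proof. by apply: measurable_sum => i; exact: measurable_gap. Qed.

Lemma measurable_past_weight m t : measurable_fun setT (past_weight m t).
Proof.
apply: (measurable_of_subsigma primitive_measurable (D := past_primitives m)).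
exact: past_weight_sub.
Qed.

Lemma void_prob_le_past_weight m t :
  ((void_prob t)%:E <= \int[P]_w (past_weight m t w)%:E)%E.
Proof.
rewrite -(void_prob_martingale m); apply: ge0_le_integral => //.
- by move=> w _; rewrite lee_fin mulr_ge0 ?past_weight_ge0 ?expR_ge0.
- apply/measurable_EFinP; apply: measurable_funM; first exact: measurable_past_weight.
  apply: (measurableT_comp measurable_void_prob); apply: measurable_funB => //.
  exact: measurable_epoch.
- by apply/measurable_EFinP; exact: measurable_past_weight.
- by move=> w _; rewrite lee_fin ler_piMr ?past_weight_ge0 ?void_prob_le1.
Qed.

(** The two weights differ only when [epoch m <= t], and then
    [1 <= e^(t - epoch m)]. *)
Lemma past_weight_le_void_prob m t :
  (\int[P]_w (past_weight m t w)%:E <=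
   (void_prob t)%:E + (expR t * gap_transform ^+ m)%:E)%E.
Proof.
have mps : measurable_fun setT
    (fun w => (past_weight m t w * void_prob (t - epoch m w))%:E).
  apply/measurable_EFinP; apply: measurable_funM; first exact: measurable_past_weight.
  apply: (measurableT_comp measurable_void_prob); apply: measurable_funB => //.
  exact: measurable_epoch.
have mep : measurable_fun setT (fun w => (expR (- epoch m w))%:E).
  apply/measurable_EFinP; apply: measurableT_comp => //; apply: measurable_funN.
  exact: measurable_epoch.
rewrite EFinM -(epoch_laplace m) -(void_prob_martingale m) -ge0_integralZl//.
have ps0 w : setT w -> (0 <= (past_weight m t w * void_prob (t - epoch m w))%:E)%E.
  by move=> _; rewrite lee_fin mulr_ge0 ?past_weight_ge0 ?expR_ge0.
have et0 w : setT w -> (0 <= (expR t)%:E * (expR (- epoch m w))%:E)%E.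
  by move=> _; rewrite mule_ge0// lee_fin expR_ge0.
have met : measurable_fun setT (fun w => (expR t)%:E * (expR (- epoch m w))%:E)%E.
  by apply: emeasurable_funM => //.
rewrite -ge0_integralD//; apply: ge0_le_integral => //.
- by move=> w _; rewrite lee_fin past_weight_ge0.
- by apply/measurable_EFinP; exact: measurable_past_weight.
- exact: emeasurable_funD.
move=> w _; rewrite -EFinM -EFinD lee_fin -expRD.
have [te|et] := ltP t (epoch m w).
  rewrite /void_prob marked_mean_neg ?subr_lt0//; last first.
    by move=> u; exact: unmarked_prob_neg.
  by rewrite mulr0 oppr0 expR0 mulr1 lerDl expR_ge0.
apply: (le_trans (past_weight_le1 _ _ _)); rewrite -[leLHS]add0r lerD//.
  by rewrite mulr_ge0 ?past_weight_ge0 ?expR_ge0.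
by rewrite -expR0 ler_expR subr_ge0.
Qed.

Lemma number_in_systemE t w : number_in_system tau N serv t w =
  (\sum_(0 <= i <oo) (batch_load i (t - tau i w) w)%:R%:E)%E.
Proof.
apply: eq_eseriesr => i _; rewrite sumEFin /batch_load natr_sum; congr EFin.
by apply: eq_bigr => k _; rewrite subr_ge0 ltrBlDl.
Qed.

Lemma number_in_system_nat t w : extended_nat (number_in_system tau N serv t w).
Proof.
rewrite number_in_systemE; apply: extended_nat_nneseries => i _.
by left; exists (batch_load i (t - tau i w) w).
Qed.

Lemma measurable_number_in_system t :
  measurable_fun setT (number_in_system tau N serv t).
Proof.
rewrite (funext (number_in_systemE t)); apply: ge0_emeasurable_sum => //.
move=> i _; apply/measurable_EFinP.
by apply: measurable_count_in_service => //; exact: measurable_funB.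
Qed.

Lemma past_weight_cvg t w :
  past_weight m t w @[m --> \oo] --> laplace s (number_in_system tau N serv t w).
Proof.
pose u m := (\sum_(0 <= i < m) (batch_load i (t - tau i w) w)%:R%:E : \bar R)%E.
rewrite (_ : (fun m => _) = (fun m => laplace s (u m))); last first.
  apply/funext => m; rewrite /u laplace_sum// big_mkord.
  by apply: eq_bigr => i _.
apply: laplace_cvg => //.
  by move=> m; rewrite /u sume_ge0.
rewrite number_in_systemE; apply: is_cvg_nneseries => i _ _.
by rewrite lee_fin.
Qed.

(** The martingale squeezes the transform of the first [m] batches between
    [void_prob t] and [void_prob t] plus a geometrically small term. *)
Theorem queue_laplace t :
  \int[P]_w laplace s (number_in_system tau N serv t w) = void_prob t.
Proof.
have mL : measurable_fun setT (fun w => laplace s (number_in_system tau N serv t w)).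
  by apply: measurable_laplace; [exact: measurable_number_in_system|exact: number_in_system_nat].
pose f m w := (past_weight m t w)%:E.
pose l w := (laplace s (number_in_system tau N serv t w))%:E.
have mf m : measurable_fun setT (f m).
  by apply/measurable_EFinP; exact: measurable_past_weight.
have ml : measurable_fun setT l by exact/measurable_EFinP.
have fl : {ae P, forall w, setT w -> f m w @[m --> \oo] --> l w}.
  apply: aeW => w _; apply: cvg_EFin; first exact: nearW.
  exact: past_weight_cvg.
have i1 : P.-integrable setT (cst 1%E : T -> \bar R).
  by apply: (@bounded_integrable _ _ _ P (cst 1) 1) => // w; rewrite normr1.
have fb : {ae P, forall w m, setT w -> (`|f m w| <= cst 1 w)%E}.
  apply: aeW => w m _; rewrite lee_fin ger0_norm ?past_weight_ge0//.
  exact: past_weight_le1.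
have [_ _ cvgI] := dominated_convergence measurableT mf ml fl i1 fb.
rewrite /Rintegral; suff -> : (\int[P]_w l w = (void_prob t)%:E)%E by [].
have rho01 : `|gap_transform| < 1.
  have l1 : 0 < lambda + 1 by rewrite addr_gt0.
  rewrite ger0_norm ?divr_ge0 ?(ltW lambda_gt0) ?(ltW l1)//.
  by rewrite /gap_transform ltr_pdivrMr// mul1r ltrDl.
have cvgr : (void_prob t)%:E + (expR t * gap_transform ^+ m)%:E @[m --> \oo] -->
    (void_prob t)%:E.
  rewrite -[X in _ --> X]adde0; apply: cvgeD => //; first exact: cvg_cst.
  apply: cvg_EFin; first exact: nearW.
  rewrite -[X in _ --> X](mulr0 (expR t)).
  by apply: cvgMr; exact: cvg_expr.
apply: (cvg_unique _ cvgI); first exact: ereal_hausdorff.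
apply: (squeeze_cvge _ (cvg_cst _) cvgr); apply: nearW => m.
by rewrite void_prob_le_past_weight past_weight_le_void_prob.
Qed.

End queue.

(** * Order statistics and exceedance counts *)

(** In a sorted list the entries that exceed [u] form a final segment. *)
Lemma sorted_nth_gt (R : realType) (l : seq R) (u : R) (j : nat) :
  sorted <=%R l -> (j < size l)%N ->
  (u < nth 0 l j) = (size l - j <= count (fun x => u < x)%R l)%N.
Proof.
elim: l j => [//|x l IH] j /= xl jl.
have sl : sorted <=%R l by exact: path_sorted xl.
have xmin : all (fun y => x <= y) l by exact: order_path_min le_trans xl.
have [ux|xu] := ltP u x; last first.
  rewrite add0n; case: j jl => [_|j jl] /=.
    by rewrite subn0 ltNge xu/= leqNgt ltnS count_size.
  by rewrite IH// subSS.
have : all (fun y => u < y)%R l by apply: sub_all xmin => y; exact: lt_le_trans.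
rewrite all_count => /eqP ->.
rewrite add1n leq_subr; case: j jl => [//|j jl] /=.
by apply: (lt_le_trans ux); apply: (allP xmin); exact: mem_nth.
Qed.

Section order_statistics.
Context (R : realType) (T : Type) (n : nat) (X : 'I_n -> T -> R).

(** The condition [0 <= u] makes the count vanish for negative levels, so that
    levels can range over the whole line. *)
Definition exceedances (u : R) (w : T) : nat := \sum_(k < n) ((0 <= u < X k w)%R : nat).

Lemma order_stat_gt j w u : (1 <= j <= n)%N ->
  (u < order_stat X j w) = (n - j + 1 <= \sum_(k < n) ((u < X k w)%R : nat))%N.
Proof.
case: j => [//|j] /andP[_ jn].
have sX : size (sort <=%R [seq X k w | k : 'I_n]) = n.
  by rewrite size_sort size_image card_ord.
rewrite /order_stat sorted_nth_gt ?sX ?sort_le_sorted//.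
rewrite count_sort -sum1_count big_mkcond big_image /= addn1 -subnSK//.
Qed.

Lemma order_stat_ge0 j w : (j <= n)%N -> (forall k, 0 <= X k w) -> 0 <= order_stat X j w.
Proof.
case: j => [//|j] jn X0; rewrite /order_stat.
have /mapP[k _ ->] : nth 0 (sort <=%R [seq X k w | k : 'I_n]) j \in [seq X k w | k : 'I_n].
  rewrite -(mem_sort <=%R); apply: mem_nth.
  by rewrite size_sort size_image card_ord.
exact: X0.
Qed.

Lemma order_stat_le j w : (1 <= j <= n)%N -> (forall k, 0 <= X k w) ->
  order_stat X j.-1 w <= order_stat X j w.
Proof.
case: j => [//|[|j]] jn X0; first exact: order_stat_ge0.
rewrite leNgt -[j.+2.-1]/j.+1; apply/negP.
have := order_stat_gt w (order_stat X j.+2 w) jn; rewrite ltxx.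
by rewrite order_stat_gt; lia.
Qed.

(** For [u >= 0] the count is the number of ranks whose order statistic exceeds
    [u].  The convention that the order statistic of rank 0 is 0 covers the levels below the
    smallest value. *)
Lemma order_stat_spacing j w : (1 <= j <= n)%N -> (forall k, 0 <= X k w) ->
  [set u | exceedances u w = n - j + 1]%N =
  `[order_stat X j.-1 w, order_stat X j w[%classic.
Proof.
move=> jn X0; have /andP[j1 jn'] := jn.
have gt_pred u : 0 <= u -> (u < order_stat X j.-1 w) =
    (n - j + 2 <= \sum_(k < n) ((u < X k w)%R : nat))%N.
  move=> u0; case: j j1 jn jn' => [//|[|j]] j1 jn jn'.
    rewrite /=; rewrite ltNge u0/=; apply/esym/negbTE; rewrite -ltnNge.
    apply: (@leq_ltn_trans (\sum_(k < n) 1)%N).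
      by apply: leq_sum => k _; exact: leq_b1.
    by rewrite sum1_card card_ord; lia.
  rewrite -[j.+2.-1]/j.+1 order_stat_gt ?(ltnW jn')//; congr (_ <= _)%N.
  by lia.
have exE u : 0 <= u -> exceedances u w = (\sum_(k < n) ((u < X k w)%R : nat))%N.
  by move=> u0; apply: eq_bigr => k _; rewrite u0.
apply/seteqP; split => u /=; rewrite in_itv/=.
  have [u0|u0] := leP 0 u; last first.
    by rewrite /exceedances big1 ?addn1// => k _; rewrite leNgt u0.
  rewrite exE// => cE; rewrite leNgt gt_pred// order_stat_gt// cE.
  by rewrite leqnn andbT -ltnNge addn2 addn1.
move=> /andP[Su uS].
have u0 : 0 <= u.
  by apply: le_trans Su; apply: order_stat_ge0 => //; exact: leq_trans (leq_pred _) _.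
move: uS; rewrite order_stat_gt// exE//; move: Su; rewrite leNgt gt_pred// -ltnNge.
by rewrite addn2 addn1 ltnS => h1 h2; apply/eqP; rewrite eqn_leq h1.
Qed.

Lemma exceedances_le u w : (exceedances u w <= n)%N.
Proof.
rewrite -[leqRHS]card_ord -sum1_card; apply: leq_sum => k _; exact: leq_b1.
Qed.

End order_statistics.

Lemma measurable_order_stat (R : realType) d (T : measurableType d) (n : nat)
    (X : 'I_n -> T -> R) (j : nat) :
  (forall k, measurable_fun setT (X k)) -> (j <= n)%N ->
  measurable_fun setT (order_stat X j).
Proof.
move=> mX; case: j => [_|j jn]; first exact: measurable_cst.
apply: (measurability _ (RGenOInfty.measurableE R)) => _ [_ [x ->] <-].
rewrite setTI.
pose c w : R := \sum_(k < n) (if x < X k w then 1 else 0).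
have mc : measurable_fun setT c.
  apply: measurable_sum => k; apply: measurable_fun_ifT => //.
  exact: measurable_fun_ltr.
rewrite (_ : _ @^-1` _ = c @^-1` `[(n - j.+1 + 1)%:R, +oo[%classic).
  by rewrite -[_ @^-1` _]setTI; exact: mc.
have cE w : c w = (\sum_(k < n) ((x < X k w)%R : nat))%N%:R.
  by rewrite natr_sum; apply: eq_bigr => k _; case: ifP.
by apply/seteqP; split => w; have := @order_stat_gt R T n X j.+1 w x jn;
  rewrite /= !in_itv/= !andbT cE ler_nat => ->.
Qed.

(** A positive [c] at most [n] equals [n - j + 1] for exactly one rank [j]. *)
Lemma sum_spacing_indicator (R : realType) (n : nat) (f : nat -> R)
    (c : nat) : (c <= n)%N -> f 0%N = 0 ->
  \sum_(1 <= j < n.+1) f (n - j + 1)%N * (c == n - j + 1)%N%:R = f c.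
Proof.
move=> cn f0; have [c0|c0] := posnP c.
  by rewrite c0 f0 big1 // => j _; rewrite (_ : (0 == _)%N = false) ?mulr0//; lia.
rewrite (bigD1_seq (n - c + 1)%N) ?iota_uniq ?mem_index_iota//=; last by lia.
rewrite (_ : (n - (n - c + 1) + 1 = c)%N) ?eqxx ?mulr1; last by lia.
rewrite big_nat_cond big1 ?addr0// => j /andP[jn jc].
by rewrite (_ : (c == _)%N = false) ?mulr0//; lia.
Qed.

(** * Spacings of an i.i.d. sample *)

Lemma in_mkset T (b : T -> bool) x : (x \in [set y | b y]) = b x.
Proof. by apply/idP/idP => [/set_mem|/mem_set]. Qed.

Lemma measurable_unmarked_service (R : realType) (G : probability R R) (s : R) :
  measurable_fun setT (unmarked_service G s : measurableTypeR R -> R).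
Proof.
pose f (x : measurableTypeR R * R) : \bar R := (if 0 <= x.1 < x.2 then expR (- s) else 1)%:E.
apply/measurable_EFinP.
rewrite (_ : EFin \o unmarked_service G s = fubini_F G f); last first.
  apply/funext => u; rewrite /fubini_F /f/= /unmarked_service.
  rewrite -(integral_two_valued G (measurable_in_service u) (expR_ge0 _)).
  by apply: eq_integral => x _; rewrite in_mkset.
apply: measurable_fun_fubini_tonelli_F => //; last first.
  by move=> x; rewrite lee_fin; case: ifP => // _; exact: expR_ge0.
apply/measurable_EFinP; apply: measurable_fun_ifT => //; apply: measurable_and.
  by apply: measurable_fun_ler => //; exact: measurable_fst.
by apply: measurable_fun_ltr; [exact: measurable_fst|exact: measurable_snd].
Qed.

Section sample.
Context (R : realType) (G : probability R R) (d1 : measure_display)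
  (T1 : measurableType d1) (P1 : probability T1 R) (n : nat)
  (X : 'I_n -> {RV P1 >-> R}).
Hypothesis iid : iid_sample X G.
Hypothesis G0 : G `]-oo, 0[%classic = 0%E.
Variable s : R.
Hypothesis s_gt0 : 0 < s.
Local Notation mu := (@lebesgue_measure R).
Local Notation c := (exceedances (fun k => X k : T1 -> R)).

Lemma sample_transform u :
  (\int[P1]_w (expR (- (s * (c u w)%:R)))%:E = (unmarked_service G s u ^+ n)%:E)%E.
Proof.
pose f (k : 'I_n) w : \bar R :=
  (if w \in X k @^-1` [set x | 0 <= u < x] then expR (- s) else 1)%:E.
have mA k : measurable (X k @^-1` [set x | 0 <= u < x]).
  by rewrite -[_ @^-1` _]setTI; apply: measurable_funP => //; exact: measurable_in_service.
transitivity (\int[P1]_w \prod_(k <- index_enum 'I_n) f k w)%E.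
  apply: eq_integral => w _; rewrite /exceedances natr_sum mulr_sumr -sumrN expR_sum -prodEFin.
  apply: eq_bigr => k _; congr EFin; rewrite (in_mkset (fun w => 0 <= u < X k w)).
  by case: ifP => _; rewrite ?mulr1 // mulr0 oppr0 expR0.
have [indX lawX] := iid.
rewrite (subsigma_integral_prod (F := fun k => sigma_rv (X k)) _ _ _ indX)//.
- under eq_bigr => k _.
    rewrite integral_two_valued ?expR_ge0//.
    rewrite (_ : P1 _ = G [set x | 0 <= u < x]); last exact: lawX (measurable_in_service u).
    over.
  by rewrite prodEFin prodr_const card_ord.
- by move=> k; exact: sigma_rv_setI_closed.
- by move=> k; exact: sigma_rv_setT.
- by move=> k; exact: sigma_rv_measurable.
- exact: index_enum_uniq.
- move=> k _; apply/measurable_EFinP.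
  have mg : measurable_fun setT (fun x : R =>
      if x \in [set x | 0 <= u < x] then expR (- s) else 1).
    apply: measurable_fun_ifT => //.
    exact: measurable_fun_mem (measurable_in_service u).
  by apply: (measurableT_comp mg); exact: (measurable_subsigma_rv (i := k)).
- by move=> k w; rewrite lee_fin; case: ifP => // _; exact: expR_ge0.
Qed.

Lemma measurable_exceedances :
  measurable_fun setT (fun x : measurableTypeR R * T1 => (c x.1 x.2)%:R : R).
Proof.
rewrite /exceedances; under eq_fun do rewrite natr_sum.
apply: measurable_sum => k.
rewrite (_ : (fun x => _) = (fun x => if 0 <= x.1 < X k x.2 then 1 else 0 : R)).
  apply: measurable_fun_ifT => //; apply: measurable_and.
    by apply: measurable_fun_ler => //; exact: measurable_fst.
  apply: measurable_fun_ltr; first exact: measurable_fst.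
  exact: (measurableT_comp _ measurable_snd).
by apply/funext => x; case: ifP.
Qed.

Let h m (x : measurableTypeR R * T1) : \bar R := (c x.1 x.2 == m)%:R%:E.

Let mh m : measurable_fun setT (h m).
Proof.
have mc := measurable_exceedances.
apply/measurable_EFinP.
rewrite (_ : (fun x => _) = (fun x : measurableTypeR R * T1 =>
  if (c x.1 x.2)%:R == m%:R :> R then 1 else 0 : R)); last first.
  by apply/funext => x; rewrite eqr_nat; case: eqP.
apply: measurable_fun_ifT => //; exact: measurable_fun_eqr.
Qed.

Let h0 m x : (0 <= h m x)%E. Proof. by rewrite lee_fin. Qed.

(** The service distribution gives no mass to negative values. *)
Lemma sample_ge0 : {ae P1, forall w k, 0 <= X k w}.
Proof.
apply: filter_forall => k.
exists (X k @^-1` `]-oo, 0[); split.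
- by rewrite -[_ @^-1` _]setTI; exact: measurable_funP.
- by have [_ /(_ k) ->] := iid.
- by move=> w /= /negP; rewrite in_itv/= -ltNge.
Qed.

(** By Tonelli's theorem, since for almost every sample the levels with
    [n - j + 1] exceedances form an interval whose length is the spacing. *)
Lemma spacing_expectation j : (1 <= j <= n)%N ->
  (\int[mu]_u \int[P1]_w h (n - j + 1)%N (u, w) =
   'E_P1[(fun w => order_stat (fun k => X k : T1 -> R) j w -
       order_stat (fun k => X k : T1 -> R) j.-1 w)%R])%E.
Proof.
move=> jn; have /andP[j1 jn'] := jn.
rewrite (fubini_tonelli (h (n - j + 1)%N))// unlock.
have mX k : measurable_fun setT (X k) by [].
apply: ae_eq_integral => //.
- exact: (measurable_fun_fubini_tonelli_G (m1 := mu) (h (n - j + 1)%N)).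
- apply/measurable_EFinP; apply: measurable_funB; apply: measurable_order_stat => //.
  exact: leq_trans (leq_pred _) _.
have := sample_ge0; apply: filterS => w X0 _.
have AE := order_stat_spacing (X := fun k => X k : T1 -> R) jn X0.
transitivity (mu [set u | c u w = n - j + 1]%N).
  rewrite -[X in mu X]setIT -integral_indic//; last by rewrite AE.
  apply: eq_integral => u _; rewrite indicE /h/=; congr (_%:R)%:E.
  by congr nat_of_bool; apply/eqP/idP => [/mem_set|/set_mem].
rewrite AE lebesgue_measure_itv/= lte_fin.
have := order_stat_le (X := fun k => X k : T1 -> R) jn X0; rewrite le_eqVlt => /predU1P[->|->//].
by rewrite ltxx subrr.
Qed.

Lemma spacing_expectation_ge0 j : (1 <= j <= n)%N ->
  (0 <= 'E_P1[(fun w => order_stat (fun k => X k : T1 -> R) j w -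
       order_stat (fun k => X k : T1 -> R) j.-1 w)%R])%E.
Proof.
by move=> jn; rewrite -spacing_expectation//; apply: integral_ge0 => u _; exact: integral_ge0.
Qed.

(** Write [1 - unmarked_service u ^+ n] as the mean of [1 - z^c] over the
    exceedance count [c], and sort the levels [u] by the value of [c]. *)
Lemma spacing_decomposition :
  (\int[mu]_u (1 - unmarked_service G s u ^+ n)%:E =
   \sum_(1 <= j < n.+1) (1 - expR (- (s * (n - j + 1)%:R)))%:E *
     'E_P1[(fun w => order_stat (fun k => X k : T1 -> R) j w -
       order_stat (fun k => X k : T1 -> R) j.-1 w)%R])%E.
Proof.
pose a j : R := 1 - expR (- (s * (n - j + 1)%:R)).
have a0 j : 0 <= a j.
  by rewrite subr_ge0 -expR0 ler_expR oppr_le0 mulr_ge0// ltW.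
transitivity (\int[mu]_u \int[P1]_w \sum_(1 <= j < n.+1) ((a j)%:E * h (n - j + 1)%N (u, w)))%E.
  apply: eq_integral => u _.
  transitivity (\int[P1]_w (1 - expR (- (s * (c u w)%:R)))%:E)%E.
    have me : measurable_fun setT (fun w => expR (- (s * (c u w)%:R))).
      apply: measurableT_comp => //; apply: measurableT_comp => //.
      by apply: measurable_funM => //; exact: (measurable_fun_pair2 u measurable_exceedances).
    have e01 w : `|expR (- (s * (c u w)%:R))| <= 1.
      by rewrite ger0_norm ?expR_ge0// -expR0 ler_expR oppr_le0 mulr_ge0// ltW.
    under eq_integral do rewrite EFinB.
    rewrite integralB_EFin//; last 2 first.
    - by apply: (@bounded_integrable _ _ _ P1 (cst 1) 1) => // w; rewrite normr1.
    - exact: bounded_integrable e01.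
    rewrite sample_transform integral_cst// [X in (1 * X)%E](probability_setT P1).
    by rewrite mule1.
  apply: eq_integral => w _.
  rewrite -(@sum_spacing_indicator _ n (fun i => 1 - expR (- (s * i%:R))))//.
  - by rewrite -sumEFin; apply: eq_bigr => j _; rewrite EFinM.
  - exact: exceedances_le.
  - by rewrite mulr0 oppr0 expR0 subrr.
transitivity (\int[mu]_u \sum_(1 <= j < n.+1)
    ((a j)%:E * fubini_F P1 (h (n - j + 1)%N) u))%E.
  apply: eq_integral => u _; rewrite ge0_integral_sum//.
  - apply: eq_bigr => j _; rewrite ge0_integralZl//.
    + exact: (measurable_fun_pair2 u (mh _)).
    + by rewrite lee_fin.
  - by move=> j; apply: emeasurable_funM => //; exact: (measurable_fun_pair2 u (mh _)).
  - by move=> j w _; rewrite mule_ge0// lee_fin.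
have mF j : measurable_fun setT (fubini_F P1 (h (n - j + 1)%N)).
  exact: measurable_fun_fubini_tonelli_F.
have F0 j u : (0 <= fubini_F P1 (h (n - j + 1)%N) u)%E by exact: integral_ge0.
rewrite ge0_integral_sum//; last 2 first.
- by move=> j; exact: emeasurable_funM.
- by move=> j u _; rewrite mule_ge0// lee_fin.
apply: eq_big_nat => j jn; rewrite ge0_integralZl//; last by rewrite lee_fin.
by rewrite -spacing_expectation.
Qed.
End sample.

(** * Weighted sums of independent Poisson variables *)

Section poisson_transform.
Context (R : realType) (d : measure_display) (T : measurableType d)
  (P : probability T R) (X : T -> \bar R).
Hypothesis mX : measurable_fun setT X.
Hypothesis eX : forall w, extended_nat (X w).
Variable s : R.
Hypothesis s_gt0 : 0 < s.

Lemma laplace_pmf_cvg :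
  \sum_(j < K) expR (- (s * j%:R)) * pmf_nat P X j @[K --> \oo] -->
  \int[P]_w laplace s (X w).
Proof.
have zK : (expR (- s)) ^+ K @[K --> \oo] --> 0.
  apply: cvg_expr; rewrite ger0_norm ?expR_ge0//.
  by rewrite -expR0 ltr_expR oppr_lt0.
apply/cvgrPdist_le => e e0.
move/cvgrPdist_le : zK => /(_ _ e0) zK; near=> K.
apply: (le_trans (laplace_pmf_approx P mX eX K s_gt0)).
rewrite mulrC -mulrN expRM_natl.
have : `|0 - expR (- s) ^+ K| <= e by near: K.
by rewrite sub0r normrN ger0_norm// exprn_ge0// expR_ge0.
Unshelve. all: by end_near.
Qed.

(** The transform of a Poisson variable is
    [sum_j e^(-a) a^j / j! * z^j = e^(-a (1 - z))] with [z = e^(-s)].  It is written as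
    a transform of the mean so that an infinite mean is covered: both sides are
    then 0. *)
Lemma poisson_laplace (a : \bar R) : (0 <= a)%E -> has_law P X (poisson_law a) ->
  \int[P]_w laplace s (X w) = laplace 1 (a * (1 - expR (- s))%:E)%E.
Proof.
move=> a0 law; apply: (cvg_unique _ laplace_pmf_cvg) => //.
have z1 : expR (- s) < 1 by rewrite -expR0 ltr_expR oppr_lt0.
have pmfE j : pmf_nat P X j = fine (poisson_law a [set j%:R%:E]).
  by rewrite /pmf_nat law//; exact: emeasurable_set1.
case: a a0 law pmfE => [r r0 law pmfE|_ law pmfE|//]; last first.
  rewrite gt0_mulye ?lte_fin ?subr_gt0// laplace_pinfty//.
  rewrite (_ : (fun K => _) = cst 0); first exact: cvg_cst.
  apply/funext => K; rewrite /= big1// => j _.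
  by rewrite pmfE /poisson_law diracE memNset//= mulr0.
have pE j : pmf_nat P X j = exp_coeff r j * expR (- r).
  rewrite pmfE /poisson_law (_ : [set k | _] = [set j]); last first.
    apply/seteqP; split => k /=; last by move=> ->.
    by move=> /eqP; rewrite eqe eqr_nat => /eqP.
  rewrite /poisson_prob /exp_coeff; move: r0; rewrite lee_fin le_eqVlt.
  move=> /predU1P[<-|r0]; last by rewrite r0 esum_set1 ?lee_fin ?poisson_pmf_ge0// /poisson_pmf r0.
  rewrite ltxx diracE oppr0 expR0 mulr1.
  case: j => [|j]; first by rewrite mem_set//= expr0 fact0 divr1.
  by rewrite memNset//= expr0n mul0r.
rewrite (_ : laplace _ _ = expR (- r) * expR (r * expR (- s))); last first.
  by rewrite -EFinM laplace_fin -expRD; congr expR; ring.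
rewrite (_ : (fun K => _) = (fun K => expR (- r) * series (exp_coeff (r * expR (- s))) K)).
  by apply: cvgMr; exact: is_cvg_series_exp_coeff.
apply/funext => K; rewrite /series/= big_mkord mulr_sumr; apply: eq_bigr => j _.
rewrite pE (_ : expR (- (s * j%:R)) = expR (- s) ^+ j); last first.
  by rewrite -expRM_natl; congr expR; ring.
by rewrite /exp_coeff/= exprMn; ring.
Qed.

End poisson_transform.

Section compound_poisson.
Context (R : realType) (d : measure_display) (T : measurableType d)
  (P : probability T R) (Y : nat -> nat -> {RV P >-> \bar R})
  (a : nat -> nat -> \bar R) (c : nat -> nat -> nat).
Hypothesis c_gt0 : forall j n, (1 <= j <= n)%N -> (0 < c j n)%N.
Hypothesis a_ge0 : forall j n, (1 <= j <= n)%N -> (0 <= a j n)%E.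
Hypothesis eY : forall j n w, (1 <= j <= n)%N -> extended_nat (Y j n w).
Hypothesis lawY : forall j n, (1 <= j <= n)%N -> has_law P (Y j n) (poisson_law (a j n)).
Hypothesis indY : mutually_independent P [set jn : nat * nat | (1 <= jn.1 <= jn.2)%N]
  (fun jn => sigma_rv (Y jn.1 jn.2)).

Definition weighted_sum (w : T) : \bar R :=
  (\sum_(1 <= n <oo) \sum_(1 <= j < n.+1) (c j n)%:R%:E * Y j n w)%E.

Let cY_nat j n w : (1 <= j <= n)%N -> extended_nat ((c j n)%:R%:E * Y j n w)%E.
Proof. by move=> jn; apply: extended_natM; exact: eY. Qed.

Let row_nat n w : extended_nat (\sum_(1 <= j < n.+1) (c j n)%:R%:E * Y j n w)%E.
Proof.
by rewrite big_nat; apply: extended_nat_sum => j /andP[j1 jn]; apply: cY_nat; rewrite j1.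
Qed.

Lemma weighted_sum_nat w : extended_nat (weighted_sum w).
Proof. by apply: extended_nat_nneseries => n _; exact: row_nat. Qed.

Let partial_sum m w : \bar R := (\sum_(1 <= n < m) \sum_(1 <= j < n.+1) (c j n)%:R%:E * Y j n w)%E.

Let partial_sum_cvg w : partial_sum m w @[m --> \oo] --> weighted_sum w.
Proof. by apply: is_cvg_nneseries => n _ _; exact: extended_nat_ge0. Qed.

Let measurable_partial_sum m : measurable_fun setT (partial_sum m).
Proof.
apply: emeasurable_sum => n; apply: emeasurable_sum => j.
by apply: emeasurable_funM.
Qed.

Lemma measurable_weighted_sum : measurable_fun setT weighted_sum.
Proof.
apply: (emeasurable_fun_cvg partial_sum) => [m|w _]; first exact: measurable_partial_sum.
exact: partial_sum_cvg.
Qed.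

Variable s : R.
Hypothesis s_gt0 : 0 < s.

Let pairs m : seq (nat * nat) := [seq (j, n) | n <- index_iota 1 m, j <- index_iota 1 n.+1].

Let pairsP m x : x \in pairs m -> (1 <= x.1 <= x.2)%N.
Proof.
move=> /allpairsPdep[n [j [_ + ->]]]/=.
by rewrite mem_index_iota ltnS.
Qed.

Let pairs_uniq m : uniq (pairs m).
Proof.
apply: allpairs_uniq_dep; first exact: iota_uniq.
  by move=> n _; exact: iota_uniq.
by move=> [n j] [n' j'] _ _ /= [-> ->].
Qed.

Let mean j n : \bar R := (a j n * (1 - expR (- (s * (c j n)%:R)))%:E)%E.

Let mean_ge0 j n : (1 <= j <= n)%N -> (0 <= mean j n)%E.
Proof.
move=> jn; rewrite mule_ge0 ?a_ge0// lee_fin subr_ge0 -expR0 ler_expR.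
by rewrite oppr_le0 mulr_ge0// ltW.
Qed.

Let partial_laplace m :
  (\int[P]_w (laplace s (partial_sum m w))%:E =
   (laplace 1 (\sum_(1 <= n < m) \sum_(1 <= j < n.+1) mean j n)%E)%:E)%E.
Proof.
transitivity (\int[P]_w \prod_(x <- pairs m)
    (laplace s ((c x.1 x.2)%:R%:E * Y x.1 x.2 w)%E)%:E)%E.
  apply: eq_integral => w _; rewrite prodEFin; congr EFin.
  rewrite big_seq -laplace_sum//; last first.
    by move=> x /pairsP xm; apply: extended_nat_ge0; exact: cY_nat.
  by rewrite -big_seq big_allpairs_dep.
rewrite (subsigma_integral_prod _ _ _ indY)//; first last.
- by move=> x w; rewrite lee_fin laplace_ge0.
- move=> x /pairsP xm; apply/measurable_EFinP.
  apply: (@measurable_extended_nat_comp _ (subsigma (fun jn => sigma_rv (Y jn.1 jn.2)) [set x])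
    R (Y x.1 x.2) _ _ _ _ (fun y => laplace s ((c x.1 x.2)%:R%:E * y)%E)).
  + exact: (measurable_subsigma_rv (i := x)).
  + by move=> w; exact: eY.
- by move=> x /pairsP.
- by move=> x; exact: sigma_rv_measurable.
- by move=> x; exact: sigma_rv_setT.
- by move=> x; exact: sigma_rv_setI_closed.
transitivity (\prod_(x <- pairs m) (laplace 1 (mean x.1 x.2))%:E)%E.
  rewrite big_seq [RHS]big_seq; apply: eq_bigr => x /pairsP xm.
  have sc : 0 < s * (c x.1 x.2)%:R by rewrite mulr_gt0// ltr0n c_gt0.
  have mYx : measurable_fun setT (Y x.1 x.2) by [].
  rewrite /mean -(poisson_laplace mYx (fun w => eY w xm) sc (a_ge0 xm) (lawY xm)).
  rewrite /Rintegral fineK.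
    by apply: eq_integral => w _; rewrite /laplace muleA -EFinM.
  apply: integrable_fin_num => //.
  apply: (@bounded_integrable _ _ _ _ _ 1).
    by apply: measurable_laplace => // w; exact: eY.
  move=> w; rewrite ger0_norm ?laplace_ge0// laplace_le1//.
  by apply: extended_nat_ge0; exact: eY.
rewrite prodEFin big_seq -laplace_sum//; last by move=> x /pairsP xm; exact: mean_ge0.
by rewrite -big_seq big_allpairs_dep.
Qed.

(** Exponents of independent factors add up, and both the sum of the variables
    and the sum of the exponents are increasing limits of finite sums. *)
Theorem compound_poisson_laplace :
  \int[P]_w laplace s (weighted_sum w) =
  laplace 1 (\sum_(1 <= n <oo) \sum_(1 <= j < n.+1)
    a j n * (1 - expR (- (s * (c j n)%:R)))%:E)%E.
Proof.
pose f m w := (laplace s (partial_sum m w))%:E.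
pose l w := (laplace s (weighted_sum w))%:E.
have ps_nat m w : extended_nat (partial_sum m w) by exact: extended_nat_sum.
have row0 n : (0 <= \sum_(1 <= j < n.+1) mean j n)%E.
  by rewrite big_nat; apply: sume_ge0 => j /andP[j1 jn]; apply: mean_ge0; rewrite j1.
have mf m : measurable_fun setT (f m).
  by apply/measurable_EFinP; exact: measurable_laplace.
have ml : measurable_fun setT l.
  apply/measurable_EFinP; apply: measurable_laplace; last exact: weighted_sum_nat.
  exact: measurable_weighted_sum.
have fl : {ae P, forall w, setT w -> f m w @[m --> \oo] --> l w}.
  apply: aeW => w _; apply: cvg_EFin; first exact: nearW.
  apply: laplace_cvg => // m; exact: extended_nat_ge0.
have i1 : P.-integrable setT (cst 1%E : T -> \bar R).
  by apply: (@bounded_integrable _ _ _ P (cst 1) 1) => // w; rewrite normr1.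
have fb : {ae P, forall w m, setT w -> (`|f m w| <= cst 1 w)%E}.
  apply: aeW => w m _; rewrite lee_fin ger0_norm ?laplace_ge0// laplace_le1//.
  exact: extended_nat_ge0.
have [_ _ cvgI] := dominated_convergence measurableT mf ml fl i1 fb.
rewrite /Rintegral; set L := laplace 1 _.
suff -> : (\int[P]_w l w = L%:E)%E by [].
apply: (cvg_unique _ cvgI); first exact: ereal_hausdorff.
rewrite (_ : [sequence _]_m = (fun m => (laplace 1
    (\sum_(1 <= n < m) \sum_(1 <= j < n.+1) mean j n)%E)%:E)); last first.
  by apply/funext => m; exact: partial_laplace.
apply: cvg_EFin; first exact: nearW.
apply: laplace_cvg => // [m|]; first exact: sume_ge0.
by apply: is_cvg_nneseries => n _ _.
Qed.

End compound_poisson.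

(** * The limit of the void probability *)

Section marked_mean_limit.
Context (R : realType) (psi : R -> R) (lambda : R).
Local Notation mu := (@lebesgue_measure R).
Hypothesis lambda_gt0 : 0 < lambda.
Hypothesis mpsi : measurable_fun setT psi.
Hypothesis psi01 : forall x, 0 <= psi x <= 1.
Hypothesis psi_neg : forall x, x < 0 -> psi x = 1.

Let rem0 y : (0 <= (1 - psi y)%:E)%E.
Proof. by rewrite lee_fin subr_ge0; case/andP: (psi01 y). Qed.

Let mrem : measurable_fun setT (fun y => (1 - psi y)%:E).
Proof. by apply/measurable_EFinP; exact: measurable_funB. Qed.

Let marked_meanE u : ((marked_mean psi u)%:E = \int[mu]_(y in `]-oo, u]) (1 - psi y)%:E)%E.
Proof.
rewrite /marked_mean /Rintegral fineK//; apply: integrable_fin_num => //.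
exact: integrable_marked.
Qed.

Let marked_mean_le u : ((marked_mean psi u)%:E <= \int[mu]_y (1 - psi y)%:E)%E.
Proof. by rewrite marked_meanE; apply: ge0_subset_integral. Qed.

Let marked_mean_nat : (marked_mean psi n%:R)%:E @[n --> \oo] --> (\int[mu]_y (1 - psi y)%:E)%E.
Proof.
rewrite (_ : [set: _] = \bigcup_n `]-oo, n%:R]%classic); last first.
  apply/seteqP; split => // x _; exists (Num.bound `|x|) => //=.
  by rewrite in_itv/= (le_trans (ler_norm x))// ltW// archi_boundP.
under eq_fun do rewrite marked_meanE.
apply: ge0_nondecreasing_set_cvg_integral => //.
- move=> m n mn; apply/subsetPset => x /=; rewrite !in_itv/= => /le_trans; apply.
  by rewrite ler_nat.
- by move=> n; exact: measurable_funTS.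
Qed.

(** The expression decreases in [t] and stays above the limit, so it is enough to
    let [t] run through the integers. *)
Lemma marked_mean_limit :
  expR (- (lambda * marked_mean psi t)) @[t --> +oo] -->
  laplace lambda (\int[mu]_y (1 - psi y)%:E)%E.
Proof.
set M := (\int[mu]_y _)%E.
have cvgn : laplace lambda (marked_mean psi n%:R)%:E @[n --> \oo] --> laplace lambda M.
  apply: laplace_cvg => // n; rewrite lee_fin; exact: marked_mean_ge0.
apply/cvgrPdist_le => e e0.
move/cvgrPdist_le : cvgn => /(_ _ e0)[n _ /(_ n (leqnn n)) /= Hn].
near=> t.
have tn : n%:R <= t by near: t; exact: nbhs_pinfty_ge.
rewrite -laplace_fin.
have h1 : laplace lambda M <= laplace lambda (marked_mean psi t)%:E.
  by apply: laplace_homo => //; rewrite lee_fin; exact: marked_mean_ge0.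
have h2 : laplace lambda (marked_mean psi t)%:E <= laplace lambda (marked_mean psi n%:R)%:E.
  apply: laplace_homo => //; first by rewrite lee_fin; exact: marked_mean_ge0.
  by rewrite lee_fin; exact: marked_mean_homo.
move: h1 h2 Hn; move: (laplace lambda M) (laplace _ _) (laplace _ _) => L a b.
by rewrite !ler_norml => La ab /andP[Lb1 Lb2]; apply/andP; split; lra.
Unshelve. all: by end_near.
Qed.

End marked_mean_limit.

Lemma unmarked_service01 (R : realType) (G : probability R R) (s u : R) : 0 < s ->
  0 <= unmarked_service G s u <= 1.
Proof.
move=> s0; rewrite /unmarked_service.
have g0 : 0 <= fine (G [set x | 0 <= u < x]) by exact: fine_ge0.
have g1 : fine (G [set x | 0 <= u < x]) <= 1.
  rewrite -lee_fin fineK ?probability_le1//; first exact: measurable_in_service.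
  exact: fin_num_measure (measurable_in_service u).
have z0 := expR_ge0 (- s).
have z1 : expR (- s) <= 1 by rewrite -expR0 ler_expR oppr_le0 ltW.
by apply/andP; split; nra.
Qed.

Section load_mean.
Context (R : realType) (lambda : R) (G : probability R R)
  (d : measure_display) (T : measurableType d) (P : probability T R)
  (tau : nat -> {RV P >-> R}) (N : nat -> {RV P >-> nat})
  (serv : nat -> nat -> {RV P >-> R}).
Hypothesis lambda_gt0 : 0 < lambda.
Hypothesis queue : batch_arrival_queue lambda G tau N serv.
Variable s : R.
Hypothesis s_gt0 : 0 < s.
Local Notation mu := (@lebesgue_measure R).

Let p (n : nat) : \bar R := P (N 0%N @^-1` [set n]).

Let p_ge0 n : (0 <= p n)%E. Proof. exact: measure_ge0. Qed.

Let sum_batch_law : (\sum_(0 <= n <oo) p n = 1)%E.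
Proof.
(* At a negative age every batch has weight 1, whatever its size. *)
transitivity (\int[P]_w (batch_weight N serv s 0 (-1) w)%:E)%E.
  rewrite (batch_weight_expectation queue); apply: eq_eseriesr => n _.
  rewrite /unmarked_service (_ : [set x | _] = set0); last first.
    by apply/seteqP; split => // x; rewrite /= lerNr oppr0 ler10.
  by rewrite measure0 mulr0 subr0 expr1n mule1.
under eq_integral do rewrite batch_weight_neg ?ltrN10//.
by rewrite integral_cst// mul1e [LHS](probability_setT P).
Qed.

Let theta_pow n u : 0 <= unmarked_service G s u ^+ n <= 1.
Proof.
have /andP[t0 t1] := unmarked_service01 G u s_gt0.
by rewrite exprn_ge0//= exprn_ile1.
Qed.

(** Mixture over the batch size; the batch probabilities add up to 1. *)
Lemma marked_prob_series u : ((1 - unmarked_prob N serv s u)%:E =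
  \sum_(0 <= n <oo) p n * (1 - unmarked_service G s u ^+ n)%:E)%E.
Proof.
have keptE : (\sum_(0 <= n <oo) p n * (unmarked_service G s u ^+ n)%:E =
    (unmarked_prob N serv s u)%:E)%E.
  by rewrite -(unmarked_probE queue s_gt0 0) (batch_weight_expectation queue).
have addE : ((unmarked_prob N serv s u)%:E +
    \sum_(0 <= n <oo) p n * (1 - unmarked_service G s u ^+ n)%:E = 1)%E.
  rewrite -keptE -nneseriesD; last 2 first.
  - by move=> n _ _; rewrite mule_ge0// lee_fin; case/andP: (theta_pow n u).
  - by move=> n _ _; rewrite mule_ge0// lee_fin subr_ge0; case/andP: (theta_pow n u).
  rewrite -sum_batch_law; apply: eq_eseriesr => n _.
  have /andP[t0 t1] := theta_pow n u.
  rewrite -ge0_muleDr ?lee_fin ?subr_ge0// -EFinD.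
  by rewrite addrC subrK mule1.
by rewrite EFinB -[X in (X - _)%E]addE addeAC subee// add0e.
Qed.

Lemma integral_marked_prob : (\int[mu]_u (1 - unmarked_prob N serv s u)%:E =
  \sum_(0 <= n <oo) p n * \int[mu]_u (1 - unmarked_service G s u ^+ n)%:E)%E.
Proof.
have mth n : measurable_fun setT
    (fun u : measurableTypeR R => (1 - unmarked_service G s u ^+ n)%:E).
  apply/measurable_EFinP; apply: measurable_funB => //; apply: measurable_funX.
  exact: measurable_unmarked_service.
have th0 n u : (0 <= (1 - unmarked_service G s u ^+ n)%:E)%E.
  by rewrite lee_fin subr_ge0; case/andP: (theta_pow n u).
under eq_integral do rewrite marked_prob_series.
rewrite integral_nneseries//; last 2 first.
- by move=> n; exact: emeasurable_funM.
- by move=> n u _; rewrite mule_ge0.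
by apply: eq_eseriesr => n _; rewrite ge0_integralZl.
Qed.

End load_mean.

(** * The steady state *)

Section steady_state_mean.
Context (R : realType) (lambda : R) (G : probability R R)
  (d : measure_display) (T : measurableType d) (P : probability T R)
  (tau : nat -> {RV P >-> R}) (N : nat -> {RV P >-> nat})
  (serv : nat -> nat -> {RV P >-> R})
  (d1 : measure_display) (T1 : measurableType d1) (P1 : probability T1 R)
  (X : forall n : nat, 'I_n -> {RV P1 >-> R}).
Hypothesis lambda_gt0 : 0 < lambda.
Hypothesis G0 : G `]-oo, 0[%classic = 0%E.
Hypothesis queue : batch_arrival_queue lambda G tau N serv.
Hypothesis iid : forall n, iid_sample (@X n) G.
Variable s : R.
Hypothesis s_gt0 : 0 < s.

Let p (n : nat) : \bar R := P (N 0%N @^-1` [set n]).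

Let spacing j n : \bar R :=
  ('E_P1[(fun w => order_stat (@X n) j w - order_stat (@X n) j.-1 w)%R])%E.

(** Multiply the spacing decomposition for size [n] by [lambda * p n] and sum
    over [n].  Empty batches drop out because [1 - unmarked_service u ^+ 0 = 0]. *)
Lemma steady_state_mean :
  (\sum_(1 <= n <oo) \sum_(1 <= j < n.+1)
     (lambda%:E * p n * spacing j n) * (1 - expR (- (s * (n - j + 1)%:R)))%:E =
   lambda%:E * \int[lebesgue_measure]_u (1 - unmarked_prob N serv s u)%:E)%E.
Proof.
have p0 n : (0 <= p n)%E by exact: measure_ge0.
have e0 j : 0 <= 1 - expR (- (s * j%:R)).
  by rewrite subr_ge0 -expR0 ler_expR oppr_le0 mulr_ge0// ltW.
pose m n := (\int[lebesgue_measure]_u (1 - unmarked_service G s u ^+ n)%:E)%E.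
have m0 n : (0 <= m n)%E.
  apply: integral_ge0 => u _; rewrite lee_fin subr_ge0.
  have /andP[t0 t1] := unmarked_service01 G u s_gt0.
  exact: exprn_ile1.
have rowE n : (\sum_(1 <= j < n.+1)
    (lambda%:E * p n * spacing j n) * (1 - expR (- (s * (n - j + 1)%:R)))%:E =
    lambda%:E * (p n * m n))%E.
  rewrite /m (spacing_decomposition (iid n) G0 s_gt0) muleA big_nat [in RHS]big_nat.
  rewrite ge0_sume_distrr.
    by apply: eq_bigr => j _; rewrite -!muleA; congr (_ * (_ * _))%E; rewrite muleC.
  move=> j /andP[j1 jn]; rewrite mule_ge0// ?lee_fin ?e0//.
  by apply: (spacing_expectation_ge0 (iid n) G0); rewrite j1.
under eq_eseriesr do rewrite rowE.
rewrite (integral_marked_prob queue s_gt0) -nneseriesZl; last first.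
  by move=> n _; exact: mule_ge0 (p0 n) (m0 n).
rewrite [RHS](nneseries_split 0 1)//; last first.
  by move=> n _; rewrite mule_ge0 ?lee_fin ?(ltW lambda_gt0)//; exact: mule_ge0 (p0 n) (m0 n).
rewrite big_nat1.
have m00 : m 0%N = 0%E by apply: integral0_eq => u _; rewrite expr0 subrr.
by rewrite -/(m 0%N) m00 !mule0 add0e.
Qed.

End steady_state_mean.

Theorem theorem3p8 (R : realType) (lambda : R)
    (G : probability R R)
    (* the queue *)
    (d : measure_display) (T : measurableType d) (P : probability T R)
    (tau : nat -> {RV P >-> R}) (N : nat -> {RV P >-> nat})
    (serv : nat -> nat -> {RV P >-> R})
    (* for each n, an i.i.d. sample of size n from G *)
    (d1 : measure_display) (T1 : measurableType d1) (P1 : probability T1 R)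
    (X : forall n : nat, 'I_n -> {RV P1 >-> R})
    (* the independent Poisson variables *)
    (d2 : measure_display) (T2 : measurableType d2) (P2 : probability T2 R)
    (Y : nat -> nat -> {RV P2 >-> \bar R}) :
  let p (n : nat) : \bar R := P (N 0%N @^-1` [set n]) in
  let Q : R -> T -> \bar R := number_in_system tau N serv in
  let Z (w : T2) : \bar R :=
    (\sum_(1 <= n <oo) \sum_(1 <= j < n.+1) (n - j + 1)%N%:R%:E * Y j n w)%E in
  0 < lambda ->
  G `]-oo, 0[%classic = 0%E ->
  batch_arrival_queue lambda G tau N serv ->
  (forall n, iid_sample (X n) G) ->
  (forall j n w, (1 <= j <= n)%N -> extended_nat (Y j n w)) ->
  (forall j n, (1 <= j <= n)%N ->
    has_law P2 (Y j n) (poisson_law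
      (lambda%:E * p n *
       'E_P1[(fun w => order_stat (X n) j w - order_stat (X n) j.-1 w)%R])%E)) ->
  mutually_independent P2 [set jn : nat * nat | (1 <= jn.1 <= jn.2)%N]
    (fun jn => sigma_rv (Y jn.1 jn.2)) ->
  limit_in_law P Q P2 Z /\
  (forall (d3 : measure_display) (T3 : measurableType d3)
      (P3 : probability T3 R) (Qinf : {RV P3 >-> \bar R}),
    (forall w, extended_nat (Qinf w)) ->
    limit_in_law P Q P3 Qinf ->
    forall A : set (\bar R), measurable A ->
      P3 (Qinf @^-1` A) = P2 (Z @^-1` A)).
Proof.
move=> p Q Z lambda_gt0 G0 queue iid eY lawY indY.
have mQ t : measurable_fun setT (Q t) by exact: measurable_number_in_system.
have eQ t w : extended_nat (Q t w) by exact: number_in_system_nat.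
have ZE : Z = weighted_sum Y (fun j n => n - j + 1)%N by [].
have mZ : measurable_fun setT Z by rewrite ZE; exact: measurable_weighted_sum.
have eZ w : extended_nat (Z w) by rewrite ZE; exact: weighted_sum_nat.
have cvgL s : 0 < s -> \int[P]_w laplace s (Q t w) @[t --> +oo] -->
    \int[P2]_w laplace s (Z w).
  move=> s0.
  rewrite ZE (compound_poisson_laplace _ _ eY lawY indY s0); last 2 first.
  - by move=> j n _; rewrite addn1.
  - move=> j n jn; rewrite !mule_ge0 ?lee_fin ?(ltW lambda_gt0)//.
    exact: (spacing_expectation_ge0 (iid n) G0).
  rewrite (steady_state_mean lambda_gt0 G0 queue iid s0).
  rewrite (_ : laplace 1 _ = laplace lambda
    (\int[lebesgue_measure]_u (1 - unmarked_prob N serv s u)%:E)%E); last first.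
    by rewrite /laplace mul1e.
  rewrite (_ : (fun t => _) = void_prob lambda N serv s); last first.
    by apply/funext => t; exact: (queue_laplace lambda_gt0 queue s0).
  exact: (marked_mean_limit lambda_gt0 (measurable_unmarked_prob queue s0)
    (unmarked_prob01 queue s0) (@unmarked_prob_neg _ _ _ _ _ _ _ _ _ queue _ s0)).
have cvgp k : pmf_nat P (Q t) k @[t --> +oo] --> pmf_nat P2 Z k.
  exact: (laplace_cvg_pmf mQ eQ mZ eZ cvgL).
have limZ : limit_in_law P Q P2 Z.
  by move=> f cf; exact: (pmf_cvg_expectation mQ eQ mZ eZ cf cvgp).
split => // d3 T3 P3 Qinf eQinf limQ.
have mQinf : measurable_fun setT Qinf by [].
apply: (pmf_law_unique mQinf eQinf mZ eZ).
apply: (expectation_pmf_unique mQinf eQinf mZ eZ) => f cf.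
by apply: (cvg_unique _ (limQ f cf) (limZ f cf)); exact: ereal_hausdorff.
Qed.
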